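(* Consider $n$ agents with double-integrator dynamics $$\dot x_i(t)=v_i(t),\qquad \dot v_i(t)=u_i(t),\qquad i=1,\ldots,n,$$ with $x_i(t),v_i(t),u_i(t)\in\mathbb{R}^p$, interacting over an undirected graph $G$, and let each agent have an input signal $r_i(t)\in\mathbb{R}^p$ with $\dot r_i(t)=v_i^r(t)$, $\dot v_i^r(t)=a_i^r(t)$. Let the control input be $$u_i=-\alpha\sum_{j\in N_i}(x_i-x_j)+\beta\sum_{j\in N_i}(w_i-w_j)+\gamma\sum_{j\in N_i}\mathrm{sgn}(w_i-w_j)+a_i^r,\qquad i=1,\ldots,n,$$ where the filter output $w_i\in\mathbb{R}^p$ and the auxiliary filter variable $\upsilon_i\in\mathbb{R}^p$ satisfy $$\dot\upsilon_i=\sum_{j\in N_i}(x_i-x_j)-\beta\sum_{j\in N_i}(w_i-w_j)-\gamma\sum_{j\in N_i}\mathrm{sgn}(w_i-w_j)-a_i^r,$$ $$w_i=\upsilon_i-\alpha\sum_{j\in N_i}(x_i-x_j),\qquad i=1,\ldots,n,$$ with constant gains $\alpha,\beta,\gamma>0$. Suppose that: (1) the undirected graph $G$ is connected; (2) there is $\bar a^r_d>0$ such that $\sup_{t\in[0,\infty)}\|a_i^r(t)-a_j^r(t)\|_2\le\bar a^r_d$ for all $i,j=1,\ldots,n$; (3) $\sum_{i=1}^n x_i(0)=\sum_{i=1}^n r_i(0)$ and $\sum_{i=1}^n v_i(0)=\sum_{i=1}^n v_i^r(0)$; (4) the gains satisfy $$\alpha>\max\Big\{1,\ \frac{1}{\lambda_2(L)},\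 \frac{\lambda_2(L)+1}{2\lambda_2(L)}\Big\},\qquad \gamma>(n-1)\bar a^r_d,$$ $$\beta>\frac{1+\alpha^4\lambda_n^2(L)}{4\lambda_2(L)\,(\alpha\lambda_2(L)-1)(\alpha-1)}.$$ Then distributed average tracking is achieved asymptotically, i.e., for every $i=1,\ldots,n$, $$\lim_{t\to\infty}\Big\|x_i(t)-\frac1n\sum_{j=1}^n r_j(t)\Big\|_2=0,\qquad \lim_{t\to\infty}\Big\|v_i(t)-\frac1n\sum_{j=1}^n v_j^r(t)\Big\|_2=0.$$
   Context: The graph $G=(V,E)$ has node set $V=\{1,\ldots,n\}$ and edge set $E\subseteq V\times V$, with no self edges, and it is undirected: $(j,i)\in E$ if and only if $(i,j)\in E$. The neighbor set of agent $i$ is $N_i=\{j:(j,i)\in E\}$. The adjacency matrix $[a_{ij}]\in\mathbb{R}^{n\times n}$ has $a_{ij}=1$ if $(j,i)\in E$ and $a_{ij}=0$ otherwise (not to be confused with the input acceleration $a_i^r$). The Laplacian matrix $L=[l_{ij}]\in\mathbb{R}^{n\times n}$ is $l_{ii}=\sum_{j\ne i}a_{ij}$ and $l_{ij}=-a_{ij}$ for $i\ne j$. For connected $G$ its eigenvalues, counted with multiplicity and ordered increasingly, are $0=\lambda_1(L)<\lambda_2(L)\le\cdots\le\lambda_n(L)$, and $\lambda_n^2(L)$ means $(\lambda_n(L))^2$. The function $\mathrm{sgn}(\cdot)$ is the signum function applied componentwise. $r_i$, $v_i^r$, $a_i^r$ are called the input signal, input velocity and input acceleration of agent $i$; time ranges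 over $t\ge0$, and the time argument is omitted in the control law and filter. *)

(* Defs.v *)
From HB Require Import structures.
From mathcomp Require Import all_boot all_order all_algebra.
From mathcomp Require Import all_classical all_reals all_analysis.

Set Implicit Arguments.
Unset Strict Implicit.
Unset Printing Implicit Defensive.

Import Order.TTheory GRing.Theory Num.Theory.
Import numFieldNormedType.Exports.

Local Open Scope classical_set_scope.
Local Open Scope ring_scope.

Section Spectrum.
Variables (R : realType) (n : nat).

(* The sorted list of the roots, with multiplicity, of the characteristic
   polynomial; meaningful when that polynomial splits over R, which is the case
   for symmetric matrices. *)
Definition eigenvalues (A : 'M[R]_n) : seq R :=
  xget [::] [set s : seq R | sorted <=%R s /\
                             char_poly A = \prod_(a <- s) ('X - a%:P)].

(* Numbered from 1: lambda_ 1 A <= lambda_ 2 A <= ... <= lambda_ n A. *)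
Definition lambda_ (k : nat) (A : 'M[R]_n) : R := nth 0 (eigenvalues A) k.-1.

End Spectrum.

(* A graph is given by its edge relation: E j i stands for (j, i) \in E. *)
Section Graph.
Variables (R : realType) (n : nat) (E : rel 'I_n).

Definition neighbors (i : 'I_n) : {set 'I_n} := [set j | E j i].

Definition adjacency : 'M[R]_n := \matrix_(i, j) (E j i)%:R.

Definition laplacian : 'M[R]_n :=
  \matrix_(i, j) if i == j then \sum_(k | k != i) adjacency i k
                 else - adjacency i j.

Definition graph_connected := forall i j, connect E i j.

End Graph.

(* The library norm on matrices is the sup norm. *)
Definition norm2 (R : realType) (p : nat) (u : 'rV[R]_p) : R :=
  Num.sqrt (\sum_(k < p) u 0 k ^+ 2).

Definition sgnv (R : realType) (p : nat) (u : 'rV[R]_p) : 'rV[R]_p :=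
  map_mx Num.sg u.

Section Solutions.
Variables (R : realType) (m k : nat).
Local Notation M := 'M[R]_(m, k).

Definition abs_continuous (a b : R) (g : R -> R) :=
  forall eps : R, 0 < eps -> exists2 delta : R, 0 < delta &
    forall (N : nat) (l u : 'I_N -> R),
      (forall i, a <= l i /\ l i <= u i /\ u i <= b) ->
      (forall i j, i != j -> u i <= l j \/ u j <= l i) ->
      \sum_(i < N) (u i - l i) < delta ->
      \sum_(i < N) `|g (u i) - g (l i)| < eps.

(* Solutions on [0, +oo[ of y'(t) \in F(t, y(t)): locally absolutely continuous
   curves satisfying the inclusion at almost every time. *)
Definition inclusion_solution (F : R -> M -> set M) (y : R -> M) :=
  (forall (T : R) i j, 0 < T -> abs_continuous 0 T (fun s => y s i j)) /\
  {ae (@lebesgue_measure R), forall t : R, 0 < t ->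
     exists2 dy : M, F t (y t) dy &
       forall i j, is_derive t (1 : R) (fun s => y s i j) (dy i j)}.

Definition caratheodory_solution (f : R -> M -> M) : (R -> M) -> Prop :=
  inclusion_solution (fun t z => [set f t z]).

Definition box (a b : M) : set M := [set z | forall i j, a i j <= z i j <= b i j].

(* Null sets for the Lebesgue measure of the space of m x k matrices. *)
Definition lebesgue_null (A : set M) :=
  forall eps : R, 0 < eps -> exists a b : nat -> M,
    [/\ forall q i j, a q i j <= b q i j,
        A `<=` \bigcup_q box (a q) (b q) &
        forall Q : nat,
          \sum_(q < Q) \prod_(i < m) \prod_(j < k) (b q i j - a q i j) <= eps].

Definition closed_convex_hull (A : set M) : set M :=
  \bigcap_(C in [set C : set M |
      [/\ closed C, convex_set (C : set (convex_lmodType M)) & A `<=` C]]) C.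

(* Filippov's set-valued regularization of a discontinuous vector field. *)
Definition filippov (f : R -> M -> M) (t : R) (z : M) : set M :=
  \bigcap_(delta in [set delta : R | 0 < delta])
    \bigcap_(N in lebesgue_null) closed_convex_hull (f t @` (ball z delta `\` N)).

Definition filippov_solution (f : R -> M -> M) : (R -> M) -> Prop :=
  inclusion_solution (filippov f).

End Solutions.

(* A matrix with n rows stores one vector of R^p per agent, row i being the
   vector of agent i. *)
Section ClosedLoop.
Variables (R : realType) (n p : nat) (E : rel 'I_n) (alpha beta gamma : R).
Local Notation M := 'M[R]_(n, p).

Definition filter_output (x ups : M) : M :=
  \matrix_i (row i ups - alpha *: \sum_(j in neighbors E i) (row i x - row j x)).

Definition control (ar x w : M) : M :=
  \matrix_i (- alpha *: (\sum_(j in neighbors E i) (row i x - row j x))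
             + beta *: (\sum_(j in neighbors E i) (row i w - row j w))
             + gamma *: (\sum_(j in neighbors E i) sgnv (row i w - row j w))
             + row i ar).

Definition filter_rate (ar x w : M) : M :=
  \matrix_i ((\sum_(j in neighbors E i) (row i x - row j x))
             - beta *: (\sum_(j in neighbors E i) (row i w - row j w))
             - gamma *: (\sum_(j in neighbors E i) sgnv (row i w - row j w))
             - row i ar).

Definition state (x v ups : M) : 'M[R]_(n, p + p + p) :=
  row_mx (row_mx x v) ups.

Definition closed_loop (ar : R -> M) (t : R) (z : 'M[R]_(n, p + p + p)) :
    'M[R]_(n, p + p + p) :=
  let x := lsubmx (lsubmx z) in
  let v := rsubmx (lsubmx z) in
  let w := filter_output x (rsubmx z) in
  state v (control (ar t) x w) (filter_rate (ar t) x w).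

(* The right-hand side is discontinuous because of sgn. Filippov solutions are
   the standard notion here, since sliding along w_i = w_j is to be expected;
   curves satisfying the equations literally (with sgn 0 = 0) almost everywhere
   are admitted as well. *)
Definition trajectory (ar x v ups : R -> M) :=
  let y t := state (x t) (v t) (ups t) in
  caratheodory_solution (closed_loop ar) y \/
  filippov_solution (closed_loop ar) y.

End ClosedLoop.

(* y' = dy almost everywhere on [0, +oo[, y being locally absolutely
   continuous; every solution in the classical sense with dy continuous is one. *)
Definition has_rate (R : realType) (n p : nat) (y dy : R -> 'M[R]_(n, p)) :=
  caratheodory_solution (fun t _ => dy t) y.

(* Main.v *)
Require Import Defs.
From mathcomp Require Import all_boot all_order all_algebra.
From mathcomp Require Import all_classical all_reals all_analysis.
From mathcomp Require Import complex ring lra.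
From mathcomp Require spectral sesquilinear.

Set Implicit Arguments.
Unset Strict Implicit.
Unset Printing Implicit Defensive.

Import Order.TTheory GRing.Theory Num.Theory.
Import numFieldNormedType.Exports.

Local Open Scope classical_set_scope.
Local Open Scope ring_scope.

(** The closed loop decouples along the coordinates of [R^p].  In a fixed
    coordinate the state is read through three vectors indexed by the agents:
    the positions [x], the velocities [v] and the filter outputs
    [w = ups - alpha L x], [L] being the Laplacian.  With [z = v + w] the
    discontinuous term only enters the equation of [w]:
      [x' = z - w],  [z' = - (alpha - 1) L x - alpha L z + alpha L w],
      [w' = L x - alpha L z + (alpha - beta) L w - gamma S(w) - a],
    where [S(w)_i] is the sum of the signs of [w_i - w_j] over the neighbours
    of [i].  Let [D] be the inner product of the deviations from the mean and
    [Q f g = f^T L g].  The Lyapunov function is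
      [V = (2 alpha - 1)/2 Q x x + D x z + D z z / 2 + D w w / 2].
    Along solutions its derivative is
      [- (alpha - 1) Q x x + (2 - alpha) Q x w + D z z - alpha Q z z - D w z
       - (beta - alpha) Q w w - (gamma D w S(w) + D w a)]
    ([lyapunov_rateE]).  The last bracket is nonnegative because [D w S(w)] is
    half the total variation of [w] over the edges, which controls every
    difference [w_i - w_j] on a connected graph ([sign_flow_dominates]).  The
    spectral gap [Q f f >= lambda_2 D f f] ([laplacian_spectral_gap]) and the
    gain conditions make the rest at most [- c V] ([lyapunov_decay]), while [V]
    dominates [D x x + D z z + D w w] ([lyapunov_coercive]).

    The solutions are only absolutely continuous and, in Filippov's sense, only
    satisfy an inclusion.  Two facts deal with this.  At a state [y], the
    functional [u |-> (gradient of V at y) . f(t, u)] is continuous at [u = y]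
    even though [f] is not, because each jump of [sg (w_i - w_j)] is multiplied
    by the difference [w_i - w_j] that vanishes there; since the half-spaces
    [l <= c] are closed and convex, every Filippov velocity therefore yields the same
    derivative of [V] as [f] itself ([filippov_scalar_eq],
    [lyapunov_gradient_closed_loop_cvg]).  And an absolutely continuous function
    whose derivative is nonpositive almost everywhere is nonincreasing
    ([abs_continuous_nonincreasing]); applied to [(1 + c t) V] it gives
    [V <= V(0) / (1 + c t)], so [x] and [v = z - w] reach consensus.

    Finally the sums of [x] and of the input signals differ by a function with
    zero derivative, so the consensus value is the average of the signals
    ([sum_tracking]). *)

(** * Spectrum of a real symmetric matrix *)

Section Spectral.
Variables (R : realType) (n : nat).
Local Notation toC := (real_complex R).

Lemma char_poly_conj_diag (F : fieldType) (A P : 'M[F]_n) (d : 'rV[F]_n) :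
  P \in unitmx -> P *m A = diag_mx d *m P ->
  char_poly A = \prod_j ('X - (d 0 j)%:P).
Proof.
move=> uP PA.
have -> : \prod_j ('X - (d 0 j)%:P) = char_poly (diag_mx d).
  rewrite char_poly_trig ?diag_mx_is_trig //.
  by apply: eq_bigr => j _; rewrite mxE eqxx mulr1n.
have dP : \det (map_mx polyC P) != 0.
  by rewrite det_map_mx polyC_eq0 -unitfE -unitmxE.
apply: (mulfI dP); rewrite -det_mulmx [in RHS]mulrC -det_mulmx.
congr (\det _).
rewrite /char_poly_mx mulmxBr mulmxBl -!map_mxM PA.
by rewrite scalar_mxC.
Qed.

(** Over the complex numbers, the rows of [P] are an orthonormal basis of
    eigenvectors, with real eigenvalues [d j]. *)
Lemma symmetric_spectral (A : 'M[R]_n) : A^T = A ->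
  exists (P : 'M[R[i]]_n) (d : 'I_n -> R),
    [/\ P *m map_mx (@Num.conj _) P^T = 1%:M,
        P *m map_mx toC A = diag_mx (\row_j toC (d j)) *m P &
        char_poly A = \prod_j ('X - (d j)%:P)].
Proof.
move=> symA; set A' := map_mx toC A.
have herm : A' \is sesquilinear.hermsymmx.
  apply: spectral.realsym_hermsym.
    apply/sesquilinear.is_hermitianmxP; rewrite expr0 scale1r map_mx_id //.
    by rewrite /A' map_trmx symA.
  apply/mxOverP => i j; rewrite mxE complex_real.
  by rewrite eqxx.
have nA := spectral.hermitian_normalmx herm.
have /spectral.unitarymxP PP := spectral.spectral_unitarymx A'.
have /spectral.orthomx_spectralP eA := nA.
have rD := spectral.hermitian_spectral_diag_real herm.
have uP := spectral.spectral_unit A'.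
move: (spectral.spectralmx A') (spectral.spectral_diag A') PP eA rD uP.
move=> P D PP eA rD uP.
have eD : \row_j toC (complex.Re (D 0 j)) = D.
  apply/rowP => j; rewrite mxE; apply: RRe_real.
  by apply: (mxOverP rD).
have PA : P *m A' = diag_mx D *m P.
  by rewrite [in LHS]eA !mulmxA (mulmxV uP) mul1mx.
exists P, (fun j => complex.Re (D 0 j)); split; first exact: PP.
- by rewrite eD.
- apply: (map_poly_inj toC); rewrite map_char_poly -/A' rmorph_prod /=.
  rewrite (char_poly_conj_diag uP PA); apply: eq_bigr => j _.
  by rewrite rmorphB /= map_polyX map_polyC /= -[in LHS]eD mxE.
Qed.
End Spectral.

(** Real form of the unitary diagonalization: [a] and [b] are the real and the
    imaginary parts of a unitary matrix whose rows are eigenvectors, so that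
    each pair of rows of [a] and [b] carries one eigenvalue. *)
Lemma symmetric_diagonalization (R : realType) (n : nat) (A : 'M[R]_n) :
  A^T = A ->
  exists (a b : 'M[R]_n) (d : 'I_n -> R),
    [/\ a *m a^T + b *m b^T = 1%:M, b *m a^T = a *m b^T,
        a^T *m a + b^T *m b = 1%:M,
        a *m A = diag_mx (\row_j d j) *m a /\ b *m A = diag_mx (\row_j d j) *m b &
        char_poly A = \prod_j ('X - (d j)%:P)].
Proof.
move=> /symmetric_spectral [P [d [PP PA cA]]].
have PP' := mulmx1C PP.
pose a := map_mx (@complex.Re _) P; pose b := map_mx (@complex.Im _) P.
have ReM (x y : R[i]) : complex.Re (x * y^*) =
    complex.Re x * complex.Re y + complex.Im x * complex.Im y.
  by case: x => x1 x2; case: y => y1 y2 /=; ring.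
have ImM (x y : R[i]) : complex.Im (x * y^*) =
    complex.Im x * complex.Re y - complex.Re x * complex.Im y.
  by case: x => x1 x2; case: y => y1 y2 /=; ring.
have toCM (x : R[i]) (y : R) : complex.Re (x * (y%:C)%C) = complex.Re x * y /\
    complex.Im (x * (y%:C)%C) = complex.Im x * y.
  by case: x => x1 x2 /=; split; ring.
exists a, b, d; split => //.
- apply/matrixP => j k; have /matrixP/(_ j k)/(congr1 (@complex.Re _)) := PP.
  rewrite !mxE raddf_sum /= -big_split /= => e.
  transitivity (complex.Re ((j == k)%:R : R[i])); last by case: eqP.
  rewrite -e; apply: eq_bigr => l _; by rewrite !mxE ReM.
- apply/matrixP => j k; have /matrixP/(_ j k)/(congr1 (@complex.Im _)) := PP.
  rewrite !mxE raddf_sum /= => e; apply/eqP; rewrite -subr_eq0 -sumrB; apply/eqP.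
  transitivity (complex.Im ((j == k)%:R : R[i])); last by case: eqP.
  rewrite -e; apply: eq_bigr => l _; by rewrite !mxE ImM.
- apply/matrixP => j k; have /matrixP/(_ j k)/(congr1 (@complex.Re _)) := PP'.
  rewrite !mxE raddf_sum /= -big_split /= => e.
  transitivity (complex.Re ((j == k)%:R : R[i])); last by case: eqP.
  rewrite -e; apply: eq_bigr => l _; rewrite !mxE [in RHS]mulrC ReM.
  by rewrite [in RHS]mulrC [X in _ = _ + X]mulrC.
- have e j k : \sum_l P j l * ((A l k)%:C)%C = P j k * ((d j)%:C)%C.
    have /matrixP/(_ j k) := PA; rewrite mul_diag_mx !mxE mulrC => <-.
    by apply: eq_bigr => l _; rewrite !mxE.
  split; apply/matrixP => j k; rewrite mul_diag_mx !mxE mulrC.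
    have /(congr1 (@complex.Re _)) := e j k; rewrite raddf_sum /= (toCM _ _).1 => <-.
    by apply: eq_bigr => l _; rewrite !mxE (toCM _ _).1.
  have /(congr1 (@complex.Im _)) := e j k; rewrite raddf_sum /= (toCM _ _).2 => <-.
  by apply: eq_bigr => l _; rewrite !mxE (toCM _ _).2.
Qed.

(** When the kernel of a positive semidefinite symmetric matrix is spanned by
    the constant vector, its second smallest eigenvalue is positive and bounds
    the quadratic form from below on the vectors of zero sum. *)
Lemma symmetric_second_eigenvalue (R : realType) (n : nat) (A : 'M[R]_n) :
  (2 <= n)%N -> A^T = A ->
  (forall u : 'rV[R]_n, 0 <= (u *m A *m u^T) 0 0) ->
  (forall u : 'rV[R]_n, u *m A = 0 -> exists c, u = const_mx c) ->
  (const_mx 1 : 'rV[R]_n) *m A = 0 ->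
  [/\ 0 < lambda_ 2 A, lambda_ 2 A <= lambda_ n A &
      forall u : 'rV[R]_n, \sum_i u 0 i = 0 ->
        lambda_ 2 A * (u *m u^T) 0 0 <= (u *m A *m u^T) 0 0].
Proof.
move=> n2 symA psd ker1 A1.
have [a [b [d [ab ba ab' [aA bA] cA]]]] := symmetric_diagonalization symA.
rewrite /lambda_ /eigenvalues.
case: xgetP => [s _ [sort_s ss]|/(_ (sort <=%R [seq d j | j <- enum 'I_n]))]; last first.
  case; split; first exact: (sort_sorted le_total).
  by rewrite cA (perm_big _ (permEl (perm_sort _ _))) /= big_map big_enum.
have perm_s : perm_eq s [seq d j | j <- enum 'I_n].
  by apply: prod_XsubC_eq; rewrite -ss cA big_map big_enum.
have size_s : size s = n by rewrite (perm_size perm_s) size_map size_enum_ord.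
have eig (x : R) : x \in s -> exists2 u : 'rV[R]_n, u *m A = x *: u & u != 0.
  move=> xs; apply/eigenvalueP; rewrite eigenvalue_root_char ss.
  by rewrite root_prod_XsubC.
have ge0 (x : R) : x \in s -> 0 <= x.
  move=> /eig [u uA u0]; have := psd u; rewrite uA -scalemxAl mxE.
  have : 0 < (u *m u^T) 0 0.
    rewrite lt_neqAle; apply/andP; split; last first.
      by rewrite mxE sumr_ge0 // => i _; rewrite mxE -expr2 sqr_ge0.
    apply: contra u0; rewrite eq_sym mxE psumr_eq0; last first.
      by move=> i _; rewrite mxE -expr2 sqr_ge0.
    move=> /allP e; apply/eqP/rowP => i; have := e i (mem_index_enum i).
    by rewrite !mxE -expr2 sqrf_eq0 => /eqP.
  by move=> /pmulr_lge0 ->.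
have zero_s : 0 \in s.
  rewrite -root_prod_XsubC -ss -eigenvalue_root_char; apply/eigenvalueP.
  exists (const_mx 1); first by rewrite A1 scale0r.
  apply/eqP => /rowP /(_ (Ordinal (ltnW n2))); rewrite !mxE => /eqP.
  by rewrite oner_eq0.
have crow (j : 'I_n) : d j = 0 ->
    exists c1 c2, forall k, a j k = c1 /\ b j k = c2.
  move=> dj.
  have [c1 e1] : exists c, row j a = const_mx c.
    by apply: ker1; rewrite -row_mul aA; apply/rowP => k;
      rewrite mul_diag_mx !mxE dj mul0r.
  have [c2 e2] : exists c, row j b = const_mx c.
    by apply: ker1; rewrite -row_mul bA; apply/rowP => k;
      rewrite mul_diag_mx !mxE dj mul0r.
  exists c1, c2 => k; move/rowP: e1 => /(_ k); move/rowP: e2 => /(_ k).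
  by rewrite !mxE.
(* Both rows of an eigenvalue 0 are constant; two such pairs would contradict
   orthonormality, by the two-square identity. *)
have uniq0 (j k : 'I_n) : d j = 0 -> d k = 0 -> j = k.
  move=> dj dk; apply/eqP; apply/negPn/negP => jk.
  have [x1 [y1 e1]] := crow _ dj; have [x2 [y2 e2]] := crow _ dk.
  have n0 : (n%:R : R) != 0 by rewrite pnatr_eq0 -lt0n (ltnW n2).
  have hab i l : \sum_m (a i m * a l m + b i m * b l m) = (i == l)%:R.
    have /matrixP/(_ i l) := ab; rewrite !mxE => <-.
    by rewrite big_split /=; congr (_ + _); apply: eq_bigr => m _; rewrite mxE.
  have hba i l : \sum_m (b i m * a l m - a i m * b l m) = 0.
    apply/eqP; rewrite sumrB subr_eq0; apply/eqP.
    have /matrixP/(_ i l) := ba; rewrite !mxE.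
    by under eq_bigr do rewrite mxE; under [in RHS]eq_bigr do rewrite mxE.
  have cst (c : R) : \sum_(m < n) c = n%:R * c.
    by rewrite sumr_const card_ord mulr_natl.
  have h1 : n%:R * (x1 * x1 + y1 * y1) = 1.
    have := hab j j; rewrite eqxx mulr1n => h; rewrite -[RHS]h -cst.
    by apply: eq_bigr => m _; rewrite (e1 m).1 (e1 m).2.
  have h2 : n%:R * (x2 * x2 + y2 * y2) = 1.
    have := hab k k; rewrite eqxx mulr1n => h; rewrite -[RHS]h -cst.
    by apply: eq_bigr => m _; rewrite (e2 m).1 (e2 m).2.
  have h3 : x1 * x2 + y1 * y2 = 0.
    apply: (mulfI n0); rewrite mulr0; have := hab j k;
      rewrite (negbTE jk) mulr0n => h; rewrite -[RHS]h.
    by rewrite -cst; apply: eq_bigr => m _; rewrite (e1 m).1 (e1 m).2 (e2 m).1 (e2 m).2.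
  have h4 : y1 * x2 - x1 * y2 = 0.
    apply: (mulfI n0); rewrite mulr0; rewrite -(hba j k).
    by rewrite -cst; apply: eq_bigr => m _; rewrite (e1 m).1 (e1 m).2 (e2 m).1 (e2 m).2.
  have : (n%:R * (x2 * x2 + y2 * y2)) * (n%:R * (x1 * x1 + y1 * y1)) = 0.
    transitivity (n%:R * n%:R * ((x1 * x2 + y1 * y2) ^+ 2 + (y1 * x2 - x1 * y2) ^+ 2)).
      by ring.
    by rewrite h3 h4 expr0n /= addr0 mulr0.
  by rewrite h1 h2 mulr1 => /eqP; rewrite oner_eq0.
have [i0 d0] : exists j, d j = 0.
  by move: zero_s; rewrite (perm_mem perm_s) => /mapP[j _ ->]; exists j.
have sort_le i j : (i <= j < n)%N -> s`_i <= s`_j.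
  move=> /andP[ij jn].
  by apply: (sorted_leq_nth le_trans le_refl) => //; rewrite inE size_s // (leq_ltn_trans ij).
have in_s i : (i < n)%N -> s`_i \in s by move=> ?; rewrite mem_nth ?size_s.
have s0 : s`_0 = 0.
  apply/eqP; rewrite eq_le ge0 ?in_s ?(ltnW n2) // andbT.
  have := sort_le 0 (index 0 s); rewrite nth_index // => -> //.
  by rewrite -size_s index_mem.
have s1 : 0 < s`_1.
  rewrite lt_neqAle ge0 ?in_s // andbT eq_sym; apply/negP => /eqP e1.
  have c2 : (2 <= count_mem (0%R : R) s)%N.
    move: size_s s0 e1 n2; case: (s) => [|x [|y t]] /=; try by move=> <-.
    by move=> _ -> -> _; rewrite eqxx.
  move: c2; rewrite (permP perm_s) count_map.
  have -> : count (preim d (pred1 0)) (enum 'I_n) = count (pred1 i0) (enum 'I_n).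
    apply: eq_count => j /=; apply/eqP/eqP => [dj|-> //]; exact: uniq0.
  by rewrite count_uniq_mem ?enum_uniq // mem_enum.
(* Only the index i0 carries the eigenvalue 0, all others are at least the
   second entry of the sorted list. *)
have dge j : j != i0 -> s`_1 <= d j.
  move=> ji; have dj : d j \in s by rewrite (perm_mem perm_s) map_f ?mem_enum.
  rewrite -(nth_index 0 dj); apply: sort_le.
  have := index_mem (d j) s; rewrite dj size_s => ->; rewrite andbT lt0n.
  apply: contra ji => /eqP i_0; apply/eqP/uniq0 => //.
  by rewrite -(nth_index 0 dj) i_0.
split => //; first by apply: sort_le; rewrite ?ltn_predL; case: (n) n2 => [|[]].
move=> u u1.
pose W j := (\sum_k u 0 k * a j k) ^+ 2 + (\sum_k u 0 k * b j k) ^+ 2.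
have sq (D : 'rV[R]_n) (c : 'M[R]_n) :
    (u *m c^T *m diag_mx D *m c *m u^T) 0 0
      = \sum_j D 0 j * (\sum_k u 0 k * c j k) ^+ 2.
  rewrite -(mulmxA _ c) mxE; apply: eq_bigr => j _.
  rewrite mul_mx_diag !mxE.
  rewrite (eq_bigr (fun k => u 0 k * c j k)); last by move=> k _; rewrite mxE.
  rewrite [X in _ * X](eq_bigr (fun k => u 0 k * c j k)); last by move=> k _; rewrite mxE mulrC.
  by rewrite expr2 mulrCA mulrA.
have -> : (u *m A *m u^T) 0 0 = \sum_j d j * W j.
  rewrite -[u in u *m A]mulmx1 -ab' mulmxDr !mulmxA mulmxDl.
  rewrite -(mulmxA _ a A) aA -(mulmxA _ b A) bA !mulmxA mulmxDl mxE !sq.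
  rewrite -big_split /=.
  by apply: eq_bigr => j _; rewrite mxE -mulrDr.
have -> : (u *m u^T) 0 0 = \sum_j W j.
  rewrite -[u in u *m _]mulmx1 -ab' mulmxDr mulmxDl mxE.
  have e c : u *m (c^T *m c) = u *m c^T *m diag_mx (const_mx 1) *m c.
    by rewrite diag_const_mx mulmx1 mulmxA.
  rewrite !e !sq -big_split /=.
  by apply: eq_bigr => j _; rewrite mxE !mul1r.
rewrite mulr_sumr; apply: ler_sum => j _.
have [->|ji] := eqVneq j i0; last first.
  by apply: ler_wpM2r (dge _ ji); rewrite addr_ge0 ?sqr_ge0.
have [x1 [y1 e1]] := crow _ d0.
(* The remaining eigenvector is constant, hence orthogonal to u. *)
suff -> : W i0 = 0 by rewrite !mulr0.
rewrite /W.
under eq_bigr do rewrite (e1 _).1.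
under [X in _ + X ^+ 2]eq_bigr do rewrite (e1 _).2.
by rewrite -!mulr_suml u1 !mul0r expr0n /= addr0.
Qed.

(** * Absolutely continuous functions *)

Section AbsContinuous.
Variable R : realType.
Implicit Types (f g : R -> R) (a b : R).

Lemma abs_continuous_cst a b (c : R) : abs_continuous a b (fun=> c).
Proof.
move=> e e0; exists 1 => // N l u _ _ _.
by rewrite big1 // => i _; rewrite subrr normr0.
Qed.

Lemma abs_continuous_id a b : abs_continuous a b (fun t => t : R).
Proof.
move=> e e0; exists e => // N l u lu _; apply: le_lt_trans.
by apply: ler_sum => i _; case: (lu i) => _ [h _]; rewrite ger0_norm ?subr_ge0.
Qed.

(** A step of length below [delta] changes [g] by less than [1], hence [g] is
    bounded by its value at [a] plus the number of steps. *)
Lemma abs_continuous_bounded a b g : abs_continuous a b g ->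
  exists2 B, 0 < B & forall t, a <= t <= b -> `|g t| <= B.
Proof.
move=> /(_ 1 ltr01)[d d0 gd].
have gd1 l u : a <= l -> l <= u -> u <= b -> u - l < d -> `|g u - g l| < 1.
  move=> al lu ub uld.
  have := gd 1 (fun=> l) (fun=> u); rewrite !big_ord1; apply => //.
  by move=> i j; rewrite !ord1.
have gk (k : nat) t : a <= t <= b -> t - a < k%:R * (d / 2) -> `|g t| <= `|g a| + k%:R.
  elim: k t => [|k IH] t /andP[at1 tb]; first by rewrite mul0r subr_lt0 ltNge at1.
  move=> tk; case: (ltP (t - d / 2) a) => h.
    have : `|g t - g a| < 1 by apply: gd1 => //; lra.
    have := lerB_dist (g t) (g a); have : (0 : R) <= k%:R by [].
    rewrite -natr1; lra.
  have : `|g t - g (t - d / 2)| < 1 by apply: gd1 => //; lra.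
  have := lerB_dist (g t) (g (t - d / 2)).
  have : `|g (t - d / 2)| <= `|g a| + k%:R.
    apply: IH; first by apply/andP; split; lra.
    by move: tk; rewrite -natr1 mulrDl mul1r; lra.
  rewrite -natr1; lra.
have d2 : 0 < d / 2 by lra.
pose k := (Num.truncn (`|b - a| / (d / 2))).+1.
exists (`|g a| + k%:R).
  by have : (0 : R) < k%:R by []; have := normr_ge0 (g a); lra.
move=> t tab; apply: gk => //; rewrite -ltr_pdivrMr //.
apply: le_lt_trans (truncnS_gt _); rewrite ler_pM2r ?invr_gt0 //.
by apply: le_trans (ler_norm _); case/andP: tab; lra.
Qed.

Lemma abs_continuousD a b f g : abs_continuous a b f -> abs_continuous a b g ->
  abs_continuous a b (fun t => f t + g t).
Proof.
move=> acf acg e e0; have e2 : 0 < e / 2 by lra.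
have [d1 d10 h1] := acf _ e2; have [d2 d20 h2] := acg _ e2.
exists (Num.min d1 d2); first by rewrite lt_min d10.
move=> N l u lu dis; rewrite lt_min => /andP[s1 s2].
have := h1 _ _ _ lu dis s1; have := h2 _ _ _ lu dis s2 => k1 k2.
apply: (@le_lt_trans _ _ (\sum_(i < N) `|f (u i) - f (l i)| +
                      \sum_(i < N) `|g (u i) - g (l i)|)); last by lra.
rewrite -big_split /=; apply: ler_sum => i _.
by rewrite opprD addrACA; apply: ler_normD.
Qed.

Lemma abs_continuousM a b f g : abs_continuous a b f -> abs_continuous a b g ->
  abs_continuous a b (fun t => f t * g t).
Proof.
move=> acf acg e e0.
have [B B0 fB] := abs_continuous_bounded acf.
have [C C0 gC] := abs_continuous_bounded acg.
have e1 : 0 < e / (2 * C) by rewrite divr_gt0 // mulr_gt0.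
have e2 : 0 < e / (2 * B) by rewrite divr_gt0 // mulr_gt0.
have [d1 d10 h1] := acf _ e1; have [d2 d20 h2] := acg _ e2.
exists (Num.min d1 d2); first by rewrite lt_min d10.
move=> N l u lu dis; rewrite lt_min => /andP[s1 s2].
have := h1 _ _ _ lu dis s1; have := h2 _ _ _ lu dis s2 => k1 k2.
apply: (@le_lt_trans _ _ (C * \sum_(i < N) `|f (u i) - f (l i)| +
                      B * \sum_(i < N) `|g (u i) - g (l i)|)); last first.
  have : C * \sum_(i < N) `|f (u i) - f (l i)| < C * (e / (2 * C)).
    by rewrite ltr_pM2l.
  have : B * \sum_(i < N) `|g (u i) - g (l i)| < B * (e / (2 * B)).
    by rewrite ltr_pM2l.
  have -> : C * (e / (2 * C)) = e / 2 by field; lra.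
  have -> : B * (e / (2 * B)) = e / 2 by field; lra.
  lra.
rewrite !mulr_sumr -big_split /=; apply: ler_sum => i _.
have [al [lui ub]] := lu i.
have -> : f (u i) * g (u i) - f (l i) * g (l i) =
   (f (u i) - f (l i)) * g (l i) + f (u i) * (g (u i) - g (l i)) by ring.
apply: le_trans (ler_normD _ _) _; rewrite !normrM mulrC.
apply: lerD; apply: ler_wpM2r => //.
  by apply: gC; apply/andP; split; lra.
by apply: fB; apply/andP; split; lra.
Qed.

Lemma abs_continuousN a b f : abs_continuous a b f ->
  abs_continuous a b (fun t => - f t).
Proof.
move=> acf e e0; have [d d0 h] := acf e e0; exists d => // N l u lu dis s.
apply: le_lt_trans (h _ _ _ lu dis s); apply: ler_sum => i _.
by rewrite -opprD normrN.
Qed.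

Lemma abs_continuousB a b f g : abs_continuous a b f -> abs_continuous a b g ->
  abs_continuous a b (fun t => f t - g t).
Proof. by move=> acf acg; apply/abs_continuousD/abs_continuousN. Qed.

Lemma abs_continuousZ a b c f : abs_continuous a b f ->
  abs_continuous a b (fun t => c * f t).
Proof. by move=> acf; apply: abs_continuousM => //; apply: abs_continuous_cst. Qed.

Lemma abs_continuous_sum a b (I : Type) (r : seq I) (P : pred I) (F : I -> R -> R) :
  (forall i, abs_continuous a b (F i)) ->
  abs_continuous a b (fun t => \sum_(i <- r | P i) F i t).
Proof.
move=> acF; elim: r => [|i r IH].
  rewrite (_ : (fun t => _) = (fun=> 0)); first exact: abs_continuous_cst.
  by apply/funext => t; rewrite big_nil.
case Pi: (P i).
  rewrite (_ : (fun t => _) = (fun t => F i t + \sum_(i <- r | P i) F i t)).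
    exact: abs_continuousD.
  by apply/funext => t; rewrite big_cons Pi.
rewrite (_ : (fun t => _) = (fun t => \sum_(i <- r | P i) F i t)) //.
by apply/funext => t; rewrite big_cons Pi.
Qed.

End AbsContinuous.

Section Monotone.
Variable R : realType.
Local Notation mu := (@lebesgue_measure R).

(** [chain U s l]: the closed intervals listed in [l], rightmost first, are
    contained in [U], lie in [0, s] and do not overlap. *)
Fixpoint chain (U : set R) (s : R) (l : seq (R * R)) : Prop :=
  if l is p :: l' then
    [/\ 0 <= p.1, p.1 <= p.2, p.2 <= s, `[p.1, p.2] `<=` U & chain U p.1 l']
  else True.

Lemma chain_le U s s' l : s <= s' -> chain U s l -> chain U s' l.
Proof.
by case: l => [|p l] //= ss' [h0 h1 h2 h3 h4]; split => //; exact: le_trans ss'.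
Qed.

Lemma chain_nth U s l i : chain U s l -> (i < size l)%N ->
  let p := nth (0, 0) l i in [/\ 0 <= p.1, p.1 <= p.2 & p.2 <= s].
Proof.
elim: l s i => [|p l IH] s [|i] //= [h0 h1 h2 h3 h4] il; first by [].
have [k0 k1 k2] := IH _ _ h4 il; split => //.
by apply: le_trans k2 _; apply: le_trans h1 h2.
Qed.

Lemma chain_disjoint U s l i j : chain U s l -> (i < j < size l)%N ->
  (nth (0, 0) l j).2 <= (nth (0, 0) l i).1.
Proof.
elim: l s i j => [|p l IH] s [|i] [|j] //=.
- move=> [h0 h1 h2 h3 h4] jl.
  by have [] := chain_nth h4 jl.
- by move=> [h0 h1 h2 h3 h4] jl; apply: IH h4 jl.
Qed.

Lemma chain_measure (U : set R) s l : open U -> chain U s l ->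
  ((\sum_(p <- l) (p.2 - p.1))%:E <= mu (U `&` `]-oo, s[))%E.
Proof.
move=> oU; have mU : measurable U by exact: measurable_realfun.open_measurable.
elim: l s => [|p l IH] s /=; first by rewrite big_nil measure_ge0.
move=> [h0 h1 h2 h3 h4]; rewrite big_cons EFinD.
apply: (@le_trans _ _ (mu `[p.1, p.2[ + mu (U `&` `]-oo, p.1[))%E).
  apply: leeD (IH _ h4).
  rewrite lebesgue_measure_itv /= lte_fin; case: ltP => [//|h].
  by rewrite lee_fin; lra.
rewrite -measureU //=; first last.
- apply/seteqP; split => t //=; rewrite !in_itv /= => -[/andP[a1 a2] [_ a3]]; lra.
- exact: measurableI.
apply: le_measure; rewrite ?inE.
- by apply: measurableU => //; exact: measurableI.
- exact: measurableI.
move=> t /= [|[Ut]]; rewrite !in_itv /=.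
  move=> /andP[a1 a2]; split; last by lra.
  by apply: h3; rewrite /= in_itv /= a1 ltW.
by move=> a; split => //; lra.
Qed.

(** First-order expansion of a differentiable function, in epsilon form. *)
Lemma is_derive_le (g : R -> R) (t d e : R) : is_derive t (1 : R) g d -> 0 < e ->
  exists2 r, 0 < r & forall h, `|h| < r -> `|g (t + h) - g t - d * h| <= e * `|h|.
Proof.
move=> [dg <-] e0; have := dg; rewrite /derivable => /cvgrPdist_le /(_ _ e0).
rewrite near_withinE => /nbhs_ballP[r /= r0 hr].
exists r => // h hr'; have [->|h0] := eqVneq h 0.
  by rewrite addr0 subrr mulr0 subr0 normr0 mulr0.
have := hr h; rewrite /ball /= sub0r normrN => /(_ hr' h0).
rewrite /derive -/(derive g t 1) => hh.
have -> : g (t + h) - g t - 'D_1 g t * h =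
    - (('D_1 g t - h^-1 *: ((g \o shift t) (h *: 1) - g t)) * h).
  rewrite /GRing.scale /= mulr1 [t + h]addrC; field.
  exact: h0.
by rewrite normrN normrM ler_wpM2r.
Qed.

(** The exceptional null set is enclosed in an open set [U] of small measure.
    On [U] the increments of [g] are controlled by absolute continuity, off [U]
    by the sign of the derivative; the supremum of the points reached by such
    an estimate is the right end of the interval. *)
Lemma abs_continuous_nonincreasing (T : R) (g : R -> R) : 0 < T ->
  abs_continuous 0 T g ->
  {ae mu, forall t : R, 0 < t -> exists2 d, is_derive t (1 : R) g d & d <= 0} ->
  g T <= g 0.
Proof.
move=> T0 acg [B [mB B0 NB]].
(* It suffices to bound g T - g 0 by e * T + e. *)
suff h e : 0 < e -> g T <= g 0 + e * (T + 1).
  apply/ler_addgt0Pr => e e0; have T1 : 0 < T + 1 by lra.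
  have := h (e / (T + 1)); rewrite divr_gt0 // => /(_ isT).
  by rewrite -mulrA mulVf ?mulr1 // gt_eqF.
move=> e0; have [d d0 hd] := acg e e0.
(* The point 0 is added to the null set since nothing is known of the
   derivative there. *)
have [U [oU BU mUB]] : exists U : set R,
    [/\ open U, B `|` [set 0%R] `<=` U & (mu U < d%:E)%E].
  have mB0 : measurable (B `|` [set (0%R : R)]) by apply: measurableU.
  have zB : (mu (B `|` [set (0%R : R)]) <= 0)%E.
    have mB1 : (mu (B `|` [set (0%R : R)]) <= mu B + mu [set (0%R : R)])%E.
      exact: measureU2.
    have s0 : (mu [set (0%R : R)] <= 0)%E.
      by have /eqP := lebesgue_measure_set1 (0%R : R); rewrite eq_le => /andP[].
    have sB : (mu B <= 0)%E by have /eqP := B0; rewrite eq_le => /andP[].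
    by apply: le_trans mB1 _; rewrite -[leRHS]adde0; exact: leeD.
  have := @lebesgue_regularity_outer R (B `|` [set (0%R : R)]) d mB0.
  move=> /(_ (le_lt_trans zB (ltry _)) d0) [U [oU BU]].
  have mU : measurable U by exact: measurable_realfun.open_measurable.
  move=> h; exists U; split => //; apply: le_lt_trans h.
  have mU1 : (mu ((U `\` (B `|` [set 0%R])) `|` (B `|` [set 0%R])) <=
      mu (U `\` (B `|` [set 0%R])) + mu (B `|` [set 0%R]))%E.
    by apply: measureU2 => //; exact: measurableD.
  apply: (@le_trans _ _ (mu ((U `\` (B `|` [set 0%R])) `|` (B `|` [set 0%R])))).
    apply: le_measure; rewrite ?inE //.
      by apply: measurableU => //; exact: measurableD.
    by move=> t Ut; case: (pselect ((B `|` [set 0%R]) t)) => h; [right|left].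
  by apply: le_trans mU1 _; rewrite -[leRHS]adde0; exact: leeD.
(* S: points s for which g s - g 0 is bounded by e * s plus the increments of g
   over a chain of intervals inside U. *)
pose S := [set s : R | 0 <= s <= T /\ exists2 l, chain U s l &
   g s - g 0 <= e * s + \sum_(p <- l) `|g p.2 - g p.1|].
(* S propagates from the left of any point c to its right. *)
have step c : 0 <= c <= T -> exists2 r, 0 < r & forall s s', S s ->
    c - r < s <= c -> c <= s' < c + r -> s' <= T -> S s'.
  move=> /andP[c0 cT]; have [cU|ncU] := pselect (U c).
    have /nbhs_ballP[r /= r0 ball_r] : nbhs c U by apply: open_nbhs_nbhs; split.
    exists r => // s s' [/andP[s0 sT] [l cl hl]] /andP[s1 s2] /andP[s3 s4] s'T.
    split; first by apply/andP; split; lra.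
    exists ((s, s') :: l) => /=.
      split => //; first lra.
      move=> t /=; rewrite in_itv /= => /andP[t1 t2]; apply: ball_r.
      rewrite /ball /= ltr_norml; apply/andP; split; lra.
    rewrite big_cons /=; have := ler_norm (g s' - g s).
    have : e * s <= e * s' by rewrite ler_pM2l //; lra.
    lra.
  have cpos : 0 < c.
    rewrite lt_neqAle c0 andbT; apply/eqP => c00; apply: ncU; apply: BU.
    by right; rewrite /= -c00.
  have [d' gd d'0] : exists2 d', is_derive c (1 : R) g d' & d' <= 0.
    apply: contrapT => ngd; apply: ncU; apply: BU; left; apply: NB => /= h.
    exact/ngd/h.
  have [r r0 hr] := is_derive_le gd e0.
  exists r => // s s' [/andP[s0 sT] [l cl hl]] /andP[s1 s2] /andP[s3 s4] s'T.
  split; first by apply/andP; split; lra.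
  exists l; first by apply: chain_le cl; lra.
  have k1 : `|s - c| < r by rewrite ltr_norml; apply/andP; split; lra.
  have k2 : `|s' - c| < r by rewrite ltr_norml; apply/andP; split; lra.
  have := hr _ k1; have := hr _ k2; rewrite ![c + _]addrC !subrK.
  rewrite [`|s - c|]ler0_norm ?subr_le0 // [`|s' - c|]ger0_norm ?subr_ge0 //.
  rewrite !ler_norml => /andP[_ m1] /andP[m2 _].
  have : d' * (s' - c) <= 0 by rewrite mulr_le0_ge0 // subr_ge0.
  have : 0 <= d' * (s - c) by rewrite mulr_le0 // subr_le0.
  lra.
have S0 : S 0.
  split; first by rewrite lexx ltW.
  by exists [::] => //; rewrite big_nil subrr mulr0 addr0.
have supS : has_sup S.
  by split; [exists 0 | exists T => s [/andP[]]].
pose c := sup S.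
have c0 : 0 <= c by apply: sup_upper_bound.
have cT : c <= T by apply: ge_sup; [exists 0|move=> s [/andP[]]].
have [r r0 hr] := step c (introT andP (conj c0 cT)).
have [s Ss cs] := sup_adherent r0 supS.
have sc : s <= c by apply: sup_upper_bound.
have ST : S T.
  have [Tc|cT'] := leP T c.
    by apply: (hr s) => //; rewrite -/c in cs; lra.
  have : S (Num.min T (c + r / 2)).
    apply: (hr s) => //; rewrite -/c in cs.
    - by apply/andP; split => //; lra.
    - apply/andP; split; first by rewrite le_min; apply/andP; split; lra.
      by rewrite gt_min; apply/orP; right; lra.
    - by rewrite ge_min lexx.
  move=> /(sup_upper_bound supS); rewrite -/c ge_min => /orP[|]; lra.
have [_ [l cl hl]] := ST.
suff : \sum_(p <- l) `|g p.2 - g p.1| < e by lra.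
rewrite (big_nth (0, 0)) big_mkord; apply: hd.
- by move=> i; have [] := chain_nth cl (ltn_ord i).
- move=> i j; rewrite neq_ltn => /orP[ij|ji]; [right|left].
    by apply: chain_disjoint cl _; rewrite ij ltn_ord.
  by apply: chain_disjoint cl _; rewrite ji ltn_ord.
rewrite -lte_fin; apply: le_lt_trans mUB.
have := chain_measure oU cl; rewrite (big_nth (0, 0)) big_mkord => /le_trans; apply.
by apply: le_measure; rewrite ?inE; [apply: measurableI => //| |];
  try exact: measurable_realfun.open_measurable; exact: subIsetl.
Qed.

End Monotone.

(** * Difference forms and the Laplacian of a graph *)

Section DifferenceForm.
Variables (R : realType) (n : nat) (m : 'M[R]_n).
Implicit Types f g h : 'cV[R]_n.

(** The form [f, g |-> sum_ij m_ij (f_i - f_j) (g_i - g_j)]. *)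
Definition difference_form f g : R :=
  \sum_i \sum_j m i j * ((f i 0 - f j 0) * (g i 0 - g j 0)).

Lemma difference_formC f g : difference_form f g = difference_form g f.
Proof.
by apply: eq_bigr => i _; apply: eq_bigr => j _; rewrite [X in _ * X]mulrC.
Qed.

Lemma difference_formDr f g h :
  difference_form f (g + h) = difference_form f g + difference_form f h.
Proof.
rewrite -big_split; apply: eq_bigr => i _; rewrite -big_split; apply: eq_bigr => j _.
by rewrite /= !mxE; ring.
Qed.

Lemma difference_formZr c f g :
  difference_form f (c *: g) = c * difference_form f g.
Proof.
rewrite mulr_sumr; apply: eq_bigr => i _; rewrite mulr_sumr; apply: eq_bigr => j _.
by rewrite /= !mxE; ring.
Qed.

Lemma difference_formNr f g : difference_form f (- g) = - difference_form f g.
Proof. by rewrite -scaleN1r difference_formZr mulN1r. Qed.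

Lemma difference_formDl f g h :
  difference_form (f + g) h = difference_form f h + difference_form g h.
Proof. by rewrite difference_formC difference_formDr ![_ h _]difference_formC. Qed.

Lemma difference_formZl c f g :
  difference_form (c *: f) g = c * difference_form f g.
Proof. by rewrite difference_formC difference_formZr difference_formC. Qed.

Lemma difference_formNl f g : difference_form (- f) g = - difference_form f g.
Proof. by rewrite difference_formC difference_formNr difference_formC. Qed.

Definition difference_formE := (difference_formDl, difference_formDr,
  difference_formNl, difference_formNr, difference_formZl, difference_formZr).

Lemma difference_form_ge0 f : (forall i j, 0 <= m i j) -> 0 <= difference_form f f.
Proof.
move=> m0; apply: sumr_ge0 => i _; apply: sumr_ge0 => j _.
by rewrite mulr_ge0 // -expr2 sqr_ge0.
Qed.

Lemma difference_form_quad f g s t : (forall i j, 0 <= m i j) ->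
  0 <= s ^+ 2 * difference_form f f + 2 * s * t * difference_form f g
       + t ^+ 2 * difference_form g g.
Proof.
move=> /(difference_form_ge0 (s *: f + t *: g)).
by rewrite !difference_formE [_ g f]difference_formC; lra.
Qed.

End DifferenceForm.

(** With these weights the difference form is the inner product of the
    deviations of [f] and [g] from their means, see [mean_formE]. *)
Definition mean_weight (R : realType) n : 'M[R]_n := const_mx (2 * n%:R)^-1.

(** For an undirected graph, the difference form with these weights is
    [f^T L g], [L] being the Laplacian, see [laplacian_pairing]; the factor
    [1/2] compensates for each edge being counted in both directions. *)
Definition edge_weight (R : realType) n (E : rel 'I_n) : 'M[R]_n :=
  2^-1 *: adjacency R E.

Notation mean_form := (difference_form (mean_weight _ _)).
Notation edge_form E := (difference_form (edge_weight _ E)).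

Section GraphForms.
Variables (R : realType) (n : nat) (E : rel 'I_n).
Hypothesis symE : symmetric E.
Implicit Types f g h w : 'cV[R]_n.
Local Notation A := (adjacency R E).

(** Sum of the signs of [w_i - w_j] over the neighbours [j] of [i]. *)
Definition sign_flow w : 'cV[R]_n :=
  \col_i \sum_(j in neighbors E i) Num.sg (w i 0 - w j 0).

Lemma adjacency_sym i j : A i j = A j i.
Proof. by rewrite !mxE symE. Qed.

Lemma adjacency_ge0 i j : 0 <= A i j.
Proof. by rewrite mxE. Qed.

Lemma neighbors_sum (V : lmodType R) i (F : 'I_n -> V) :
  \sum_(j in neighbors E i) F j = \sum_j A i j *: F j.
Proof.
rewrite big_mkcond; apply: eq_bigr => j _; rewrite inE mxE.
by case: (E j i); rewrite ?scale1r ?scale0r.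
Qed.

Lemma laplacian_mulE f i : (laplacian R E *m f) i 0 = \sum_j A i j * (f i 0 - f j 0).
Proof.
rewrite mxE [RHS](bigD1 i) //= subrr mulr0 add0r (bigD1 i) //= mxE eqxx.
rewrite mulr_suml -big_split /=; apply: eq_bigr => j ji.
by rewrite [laplacian _ _ _ _]mxE eq_sym (negbTE ji); ring.
Qed.

Lemma sum_antisymmetric (k : 'I_n -> 'I_n -> R) :
  (forall i j, k i j = - k j i) -> \sum_i \sum_j k i j = 0.
Proof.
move=> ak; have : \sum_i \sum_j k i j = - \sum_i \sum_j k i j; last by lra.
rewrite {1}exchange_big /= -sumrN; apply: eq_bigr => i _.
by rewrite -sumrN; apply: eq_bigr => j _.
Qed.

Lemma sum_antisymmetric_pairing (k : 'I_n -> 'I_n -> R) f :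
  (forall i j, k i j = - k j i) ->
  \sum_i f i 0 * \sum_j k i j = \sum_i \sum_j 2^-1 * ((f i 0 - f j 0) * k i j).
Proof.
move=> ak; have e : \sum_i f i 0 * \sum_j k i j = \sum_i \sum_j - (f j 0 * k i j).
  rewrite exchange_big /=; apply: eq_bigr => i _; rewrite mulr_sumr.
  by apply: eq_bigr => j _; rewrite [k i j]ak mulrN.
have : \sum_i \sum_j 2^-1 * ((f i 0 - f j 0) * k i j) =
   2^-1 * \sum_i f i 0 * \sum_j k i j + 2^-1 * \sum_i \sum_j - (f j 0 * k i j).
  rewrite !mulr_sumr -big_split; apply: eq_bigr => i _ /=.
  rewrite !mulr_sumr -big_split; apply: eq_bigr => j _ /=; ring.
by rewrite -e; lra.
Qed.

Lemma mean_formE f g : (0 < n)%N -> mean_form f g =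
  \sum_i f i 0 * g i 0 - n%:R^-1 * (\sum_i f i 0) * (\sum_i g i 0).
Proof.
move=> n0; have n0' : (n%:R : R) != 0 by rewrite pnatr_eq0 -lt0n.
rewrite /mean_weight /difference_form.
under eq_bigr do under eq_bigr do rewrite mxE.
set c := (2 * n%:R)^-1.
transitivity (\sum_i (c * n%:R * (f i 0 * g i 0) + c * (\sum_j f j 0 * g j 0)
   - c * f i 0 * (\sum_j g j 0) - c * g i 0 * (\sum_j f j 0))).
  apply: eq_bigr => i _.
  have -> : c * n%:R * (f i 0 * g i 0) = \sum_(j < n) c * (f i 0 * g i 0).
    by rewrite sumr_const card_ord -mulr_natl; ring.
  rewrite !mulr_sumr -big_split -!sumrB /=; apply: eq_bigr => j _; ring.
rewrite !sumrB big_split /= sumr_const card_ord -!mulr_suml -!mulr_sumr -mulr_natl /c.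
by field.
Qed.

Lemma mean_form_sum0 f g : (0 < n)%N -> \sum_i g i 0 = 0 ->
  mean_form f g = \sum_i f i 0 * g i 0.
Proof. by move=> n0 g0; rewrite mean_formE // g0 mulr0 subr0. Qed.

Lemma laplacian_sum0 f : \sum_i (laplacian R E *m f) i 0 = 0.
Proof.
under eq_bigr do rewrite laplacian_mulE.
by apply: sum_antisymmetric => i j; rewrite adjacency_sym; ring.
Qed.

Lemma laplacian_pairing f g :
  \sum_i f i 0 * (laplacian R E *m g) i 0 = edge_form E f g.
Proof.
under eq_bigr do rewrite laplacian_mulE.
rewrite sum_antisymmetric_pairing; last by move=> i j; rewrite adjacency_sym; ring.
by apply: eq_bigr => i _; apply: eq_bigr => j _; rewrite [X in _ = X * _]mxE; ring.
Qed.

Lemma mean_form_laplacian f g : (0 < n)%N ->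
  mean_form f (laplacian R E *m g) = edge_form E f g.
Proof. by move=> n0; rewrite mean_form_sum0 ?laplacian_sum0 ?laplacian_pairing. Qed.

Lemma sign_flowE w i : sign_flow w i 0 = \sum_j A i j * Num.sg (w i 0 - w j 0).
Proof. by rewrite mxE (neighbors_sum _ (fun j => Num.sg (w i 0 - w j 0) : R^o)). Qed.

Lemma sign_flow_sum0 w : \sum_i sign_flow w i 0 = 0.
Proof.
under eq_bigr do rewrite sign_flowE.
by apply: sum_antisymmetric => i j; rewrite adjacency_sym -opprB sgrN mulrN.
Qed.

Lemma mean_form_sign_flow f w : (0 < n)%N -> mean_form f (sign_flow w) =
  \sum_i \sum_j 2^-1 * ((f i 0 - f j 0) * (A i j * Num.sg (w i 0 - w j 0))).
Proof.
move=> n0; rewrite mean_form_sum0 ?sign_flow_sum0 //.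
under eq_bigr do rewrite sign_flowE.
rewrite sum_antisymmetric_pairing // => i j.
by rewrite adjacency_sym -opprB sgrN mulrN.
Qed.

(** Variation over the oriented edges: each edge is counted twice. *)
Definition total_variation w := \sum_i \sum_j A i j * `|w i 0 - w j 0|.

Lemma mean_form_sign_flow_variation w : (0 < n)%N ->
  mean_form w (sign_flow w) = 2^-1 * total_variation w.
Proof.
move=> n0; rewrite mean_form_sign_flow // /total_variation mulr_sumr.
apply: eq_bigr => i _; rewrite mulr_sumr; apply: eq_bigr => j _.
by rewrite [`|_|]normrEsg; ring.
Qed.

(** Along a simple path from [i] to [j] the vertices are distinct, so each step
    is paid for by the edges leaving a different vertex. *)
Lemma dist_le_total_variation w i j : graph_connected E ->
  `|w i 0 - w j 0| <= total_variation w.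
Proof.
move=> conn; have /connectP[p0 pp0 ->] := conn i j.
case/shortenP: pp0 => p pp up _ {p0}.
pose T a := \sum_b A a b * `|w a 0 - w b 0|.
have T0 a : 0 <= T a by apply: sumr_ge0 => b _; rewrite mulr_ge0 ?adjacency_ge0.
apply: (@le_trans _ _ (\sum_(a <- belast i p) T a)).
  elim: p i pp {up} => [|y p IH] x /=; first by rewrite subrr normr0 big_nil.
  move=> /andP[xy pp]; rewrite big_cons; apply: le_trans (ler_distD (w y 0) _ _) _.
  apply: lerD (IH _ pp).
  rewrite /T (bigD1 y) //= mxE symE xy mul1r lerDl.
  by apply: sumr_ge0 => b _; rewrite mulr_ge0 ?adjacency_ge0.
have ub : uniq (belast i p).
  by apply: subseq_uniq up; rewrite lastI -cats1; apply: prefix_subseq.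
rewrite big_uniq //= /total_variation [leRHS](bigID [in belast i p]) /= lerDl.
by apply: sumr_ge0 => b _; apply: T0.
Qed.

(** The sign term absorbs the disagreement of the input accelerations. *)
Lemma sign_flow_dominates (gamma abar : R) w (a : 'cV[R]_n) :
  (2 <= n)%N -> graph_connected E ->
  0 <= abar -> (forall i j, `|a i 0 - a j 0| <= abar) -> (n%:R - 1) * abar <= gamma ->
  0 <= gamma * mean_form w (sign_flow w) + mean_form w a.
Proof.
move=> n2 conn abar0 ha hg.
have n0 : (0 < n)%N by exact: ltnW.
have np : (0 : R) < n%:R by rewrite ltr0n.
set V := total_variation w.
have V0 : 0 <= V.
  by apply: sumr_ge0 => i _; apply: sumr_ge0 => j _; rewrite mulr_ge0 ?adjacency_ge0.
rewrite mean_form_sign_flow_variation // -/V.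
have : - ((n%:R - 1) / 2 * abar * V) <= mean_form w a.
  (* The diagonal pairs vanish: this is where n - 1 comes from instead of n. *)
  have -> : - ((n%:R - 1) / 2 * abar * V) =
      \sum_(i < n) \sum_(j < n) (2 * n%:R)^-1 * - ((j != i)%:R * (V * abar)).
    transitivity (\sum_(i < n) - ((2 * n%:R)^-1 * (n%:R - 1) * (V * abar))).
      by rewrite sumr_const card_ord -mulr_natl; field; lra.
    apply: eq_bigr => i _; rewrite -mulr_sumr sumrN -mulr_suml.
    suff -> : \sum_(j < n) (j != i)%:R = n%:R - 1 :> R by ring.
    rewrite (bigD1 i) //= eqxx add0r.
    rewrite (eq_bigr (fun=> 1)); last by move=> j ->.
    by rewrite sumr_const cardC1 card_ord -subn1 natrB.
  apply: ler_sum => i _; apply: ler_sum => j _; rewrite mxE.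
  rewrite ler_pM2l; last by rewrite invr_gt0; lra.
  have [->|ji] := eqVneq j i; first by rewrite mul0r subrr mul0r oppr0.
  have : `|(w i 0 - w j 0) * (a i 0 - a j 0)| <= V * abar.
    by rewrite normrM; apply: ler_pM => //; apply: dist_le_total_variation.
  by rewrite ler_norml mul1r => /andP[].
have : (n%:R - 1) * abar * V <= gamma * V by rewrite ler_wpM2r.
lra.
Qed.

End GraphForms.

(** The second eigenvalue of the Laplacian of a connected graph is positive and
    is a Poincare constant. *)
Lemma laplacian_spectral_gap (R : realType) (n : nat) (E : rel 'I_n) :
  (2 <= n)%N -> symmetric E -> graph_connected E ->
  [/\ 0 < lambda_ 2 (laplacian R E),
      lambda_ 2 (laplacian R E) <= lambda_ n (laplacian R E) &
      forall f : 'cV[R]_n,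
        lambda_ 2 (laplacian R E) * mean_form f f <= edge_form E f f].
Proof.
move=> n2 symE conn; set L := laplacian R E.
have n0 : (0 < n)%N by exact: ltnW.
have symL : L^T = L.
  apply/matrixP => i j; rewrite !mxE eq_sym; case: eqP => [->//|_].
  by rewrite symE.
have quad (u : 'rV[R]_n) : (u *m L *m u^T) 0 0 = edge_form E u^T u^T.
  rewrite -mulmxA mxE -(laplacian_pairing symE).
  by apply: eq_bigr => i _; rewrite [u^T i 0]mxE.
have edge0 (f : 'cV[R]_n) : 0 <= edge_form E f f.
  by apply: difference_form_ge0 => i j; rewrite !mxE mulr_ge0.
have [l2 l2n gap] : [/\ 0 < lambda_ 2 L, lambda_ 2 L <= lambda_ n L &
      forall u : 'rV[R]_n, \sum_i u 0 i = 0 ->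
        lambda_ 2 L * (u *m u^T) 0 0 <= (u *m L *m u^T) 0 0].
  apply: symmetric_second_eigenvalue => //.
  - by move=> u; rewrite quad.
  - move=> u uL; have /eqP := quad u; rewrite uL mul0mx mxE eq_sym.
    rewrite /difference_form psumr_eq0; last first.
      move=> i _; apply: sumr_ge0 => j _; rewrite -expr2 mulr_ge0 ?sqr_ge0 //.
      by rewrite !mxE mulr_ge0.
    move=> /allP h; exists (u 0 (Ordinal n0)); apply/rowP => i; rewrite mxE.
    apply/eqP; rewrite -subr_eq0 -normr_eq0 eq_le normr_ge0 andbT.
    have := dist_le_total_variation symE u^T i (Ordinal n0) conn.
    rewrite ![u^T _ _]mxE => /le_trans; apply.
    rewrite /total_variation big1 // => a _; apply: big1 => b _.
    have := h a (mem_index_enum a); rewrite psumr_eq0; last first.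
      move=> j _; rewrite -expr2 mulr_ge0 ?sqr_ge0 //.
      by rewrite !mxE mulr_ge0.
    move=> /allP /(_ b (mem_index_enum b)); rewrite mulf_eq0 -expr2 sqrf_eq0.
    rewrite [X in (X == 0) || _]mxE mulf_eq0 invr_eq0 pnatr_eq0 /=.
    by case/orP => /eqP ->; rewrite ?mul0r ?normr0 ?mulr0.
  - apply/rowP => j; rewrite -[L]symL -trmx_const -trmx_mul mxE.
    rewrite laplacian_mulE [RHS]mxE; apply: big1 => k _.
    by rewrite !mxE subrr mulr0.
split => // f; pose u : 'rV[R]_n := \row_i (f i 0 - n%:R^-1 * \sum_k f k 0).
have np : (n%:R : R) != 0 by rewrite pnatr_eq0 -lt0n.
have u0 : \sum_i u 0 i = 0.
  under eq_bigr do rewrite mxE.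
  by rewrite sumrB sumr_const card_ord -[X in _ - X]mulr_natl mulrA mulfV // mul1r subrr.
have shift (m : 'M[R]_n) : difference_form m u^T u^T = difference_form m f f.
  apply: eq_bigr => i _; apply: eq_bigr => j _; rewrite !mxE; ring.
have -> : mean_form f f = (u *m u^T) 0 0.
  rewrite -[LHS]shift mean_form_sum0 //; last first.
    by rewrite -[RHS]u0; apply: eq_bigr => i _; rewrite mxE.
  by rewrite mxE; apply: eq_bigr => i _; rewrite [u^T i 0]mxE.
by have := gap u u0; rewrite quad shift.
Qed.

Lemma mean_form_deviation (R : realType) (n : nat) (f : 'cV[R]_n) : (0 < n)%N ->
  mean_form f f = \sum_i (f i 0 - n%:R^-1 * \sum_k f k 0) ^+ 2.
Proof.
move=> n0; have np : (n%:R : R) != 0 by rewrite pnatr_eq0 -lt0n.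
rewrite mean_formE //; set s := \sum_k f k 0.
transitivity (\sum_i (f i 0 * f i 0 - 2 * n%:R^-1 * s * f i 0 + (n%:R^-1 * s) ^+ 2)).
  rewrite big_split sumrB /= sumr_const card_ord -mulr_sumr -/s -[X in _ = _ + X]mulr_natl.
  by field.
by apply: eq_bigr => i _; ring.
Qed.

Lemma deviation_le_mean_form (R : realType) (n : nat) (f : 'cV[R]_n) i :
  (f i 0 - n%:R^-1 * \sum_k f k 0) ^+ 2 <= mean_form f f.
Proof.
have n0 : (0 < n)%N by apply: leq_ltn_trans (ltn_ord i).
rewrite mean_form_deviation // [leRHS](bigD1 i) //= lerDl.
by apply: sumr_ge0 => k _; rewrite sqr_ge0.
Qed.

(** * The Lyapunov function *)

Section Lyapunov.
Variables (R : realType) (n : nat) (E : rel 'I_n) (alpha beta gamma : R).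
Implicit Types x z w dx dz dw : 'cV[R]_n.
Local Notation Q := (edge_form E).
Local Notation D := mean_form.
Local Notation L := (laplacian R E).

(** The function [V], in the variables [x], [z = v + w] and [w]. *)
Definition lyapunov x z w : R :=
  (2 * alpha - 1) / 2 * Q x x + D x z + 2^-1 * D z z + 2^-1 * D w w.

(** Derivative of [V] at [(x, z, w)] in the direction [(dx, dz, dw)]. *)
Definition lyapunov_derivative x z w dx dz dw : R :=
  (2 * alpha - 1) * Q x dx + D dx z + D x dz + D z dz + D w dw.

(** One coordinate of the control inputs, as a column indexed by the agents. *)
Definition column_control x w (a : 'cV[R]_n) : 'cV[R]_n :=
  - alpha *: (L *m x) + beta *: (L *m w) + gamma *: sign_flow E w + a.

(** One coordinate of the velocities of the auxiliary filter variables. *)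
Definition column_filter_rate x w (a : 'cV[R]_n) : 'cV[R]_n :=
  L *m x - beta *: (L *m w) - gamma *: sign_flow E w - a.

(** Derivative of [V] along the equations; the filter output
    [w = ups - alpha L x] has velocity [ups' - alpha L v]. *)
Definition lyapunov_rate x v w a : R :=
  let dw := column_filter_rate x w a - alpha *: (L *m v) in
  lyapunov_derivative x (v + w) w v (column_control x w a + dw) dw.

Hypothesis n2 : (2 <= n)%N.
Hypothesis symE : symmetric E.

Lemma lyapunov_rateE x v w a :
  lyapunov_rate x v w a =
    - (alpha - 1) * Q x x + (2 - alpha) * Q x w + D (v + w) (v + w)
    - alpha * Q (v + w) (v + w) - D w (v + w) - (beta - alpha) * Q w w
    - (gamma * D w (sign_flow E w) + D w a).
Proof.
have n0 : (0 < n)%N by exact: ltnW.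
rewrite /lyapunov_rate /=; set dv := column_control _ _ _.
set dw := _ - alpha *: _; have vE : v = (v + w) - w by rewrite addrK.
have -> : dv + dw = - (alpha - 1) *: (L *m x) - alpha *: (L *m v).
  rewrite /dv /dw /column_control /column_filter_rate.
  by apply/matrixP => i j; rewrite !mxE; ring.
rewrite /lyapunov_derivative /dw /column_filter_rate; move: vE.
move: (v + w) => z -> {dv dw v}.
rewrite !mulmxBr !difference_formE.
rewrite !mean_form_laplacian //.
rewrite [Q w x]difference_formC [Q w z]difference_formC [Q z x]difference_formC.
ring.
Qed.

Lemma lyapunov_decay (abar : R) : graph_connected E -> 0 <= abar ->
  (n%:R - 1) * abar <= gamma -> 1 < alpha -> 1 < alpha * lambda_ 2 L ->
  (2 - alpha) ^+ 2 / (4 * (alpha - 1)) + 1 / (4 * lambda_ 2 L * (alpha * lambda_ 2 L - 1))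
    < beta - alpha ->
  exists2 c : R, 0 < c & forall x v w (a : 'cV[R]_n),
    (forall i j, `|a i 0 - a j 0| <= abar) ->
    lyapunov_rate x v w a <= - c * lyapunov x (v + w) w.
Proof.
move=> conn abar0 hgamma a1 al1 hbeta.
have [] := laplacian_spectral_gap R n2 symE conn.
move: al1 hbeta; set la := lambda_ 2 L => al1 hbeta la0 _ gap.
set m := alpha - 1 in hbeta; set k := alpha * la - 1 in hbeta.
set N := beta - alpha in hbeta.
have m0 : 0 < m by rewrite subr_gt0.
have k0 : 0 < k by rewrite subr_gt0.
set g1 := (2 - alpha) ^+ 2 / (4 * m) in hbeta.
set g2 := 1 / (4 * la * k) in hbeta.
have g10 : 0 <= g1 by rewrite divr_ge0 ?sqr_ge0 // mulr_ge0 // ltW.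
have g20 : 0 < g2 by rewrite divr_gt0 // !mulr_gt0.
have N0 : 0 < N by lra.
(* A fraction th < 1 of the dissipation in x and in z pays for the cross terms,
   at a cost (g1 + g2) / th < N in w. *)
pose th := ((g1 + g2) / N + 1) / 2.
have gN : (g1 + g2) / N < 1 by rewrite ltr_pdivrMr // mul1r.
have gN0 : 0 < (g1 + g2) / N by rewrite divr_gt0 //; lra.
have th1 : th < 1 by rewrite /th; lra.
have th0 : 0 < th by rewrite /th; lra.
have gth : (g1 + g2) / th < N.
  rewrite ltr_pdivrMr // mulrC -ltr_pdivrMr //; rewrite /th; lra.
pose e := Num.min ((1 - th) * m) (Num.min ((1 - th) * k) (la * (N - (g1 + g2) / th))).
have e0 : 0 < e by rewrite !lt_min !mulr_gt0 //; lra.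
pose C := alpha + 1 / (2 * la) + 1.
have la2 : 0 < 1 / (2 * la) by rewrite divr_gt0 // mulr_gt0.
have C0 : 0 < C by rewrite /C; move: la2; move: (1 / (2 * la)) => b; lra.
exists (e / C); first exact: divr_gt0.
move=> x v w a ha; rewrite lyapunov_rateE; move: (v + w) => z.
have sgn := sign_flow_dominates symE w n2 conn abar0 ha hgamma.
have D_ge0 i j : 0 <= mean_weight R n i j.
  by rewrite mxE invr_ge0 mulr_ge0 // ler0n.
have Q_ge0 i j : 0 <= edge_weight R E i j.
  by rewrite !mxE mulr_ge0 // invr_ge0.
have qxw := difference_form_quad x w (2 * th * m) (- (2 - alpha)) Q_ge0.
have dzw := difference_form_quad z w (2 * th * k) 1 D_ge0.
have dxz := difference_form_quad x z 1 (-1) D_ge0.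
have qx0 := difference_form_ge0 x Q_ge0.
have qw0 := difference_form_ge0 w Q_ge0.
have dz0 := difference_form_ge0 z D_ge0.
have dw0 := difference_form_ge0 w D_ge0.
have gx := gap x; have gw := gap w; have gz := gap z.
rewrite /lyapunov [D w z]difference_formC; move: sgn qxw dzw dxz qx0 qw0 dz0 dw0 gx gw gz.
move: (Q x x) (Q w w) (Q z z) (Q x w) (D z w) (D x z) (D w w) (D z z) (D x x).
move=> qx qw qz qxw dzw dxz dww dzz dxx sgn h1 h2 h3 qx0 qw0 dz0 dw0 gx gw gz.
(* k1 and k2 are completed squares in x, w and in z, w. *)
have k1 : 0 <= th * m * qx - (2 - alpha) * qxw + g1 / th * qw.
  have : 0 < 4 * th * m by apply: mulr_gt0 => //; apply: mulr_gt0.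
  move=> p0; rewrite -(pmulr_rge0 _ p0); apply: le_trans h1 _.
  rewrite le_eqVlt; apply/orP; left; apply/eqP; rewrite /g1; field; apply/andP; split; lra.
have k2 : 0 <= th * k * dzz + dzw + g2 / th * qw.
  apply: (@le_trans _ _ (th * k * dzz + dzw + g2 / th * (la * dww))); last first.
    by rewrite lerD2l ler_wpM2l // divr_ge0 // ltW.
  have : 0 < 4 * th * k by apply: mulr_gt0 => //; apply: mulr_gt0.
  move=> p0; rewrite -(pmulr_rge0 _ p0); apply: le_trans h2 _.
  by rewrite le_eqVlt; apply/orP; left; apply/eqP; rewrite /g2; field; rewrite !gt_eqF.
have e1 : e <= (1 - th) * m by rewrite ge_min lexx.
have e2 : e <= (1 - th) * k by rewrite !ge_min lexx orbT.
have e3 : e <= la * (N - (g1 + g2) / th) by rewrite !ge_min lexx !orbT.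
have lan0 : la != 0 by rewrite gt_eqF.
have xx : dxx <= qx / la by rewrite ler_pdivlMr // mulrC.
have ww : dww <= qw / la by rewrite ler_pdivlMr // mulrC.
have f1 : e * qx <= (1 - th) * m * qx by rewrite ler_wpM2r.
have f2 : e * dzz <= (1 - th) * k * dzz by rewrite ler_wpM2r.
have f3 : e * dww <= (N - (g1 + g2) / th) * qw.
  apply: (@le_trans _ _ (e * (qw / la))); first by rewrite ler_pM2l.
  rewrite mulrA ler_pdivrMr // mulrAC ler_wpM2r //.
  by rewrite mulrC.
have f4 : alpha * qz >= alpha * (la * dzz) by rewrite ler_wpM2l //; lra.
have V : (2 * alpha - 1) / 2 * qx + dxz + 2^-1 * dzz + 2^-1 * dww <= C * (qx + dzz + dww).
  have : dxz <= 1 / (2 * la) * qx + 2^-1 * dzz.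
    have -> : 1 / (2 * la) * qx = 2^-1 * (qx / la) by field; lra.
    lra.
  have : 0 <= (alpha + 1 / (2 * la)) * (dzz + dww).
    by move: la2; move: (1 / (2 * la)) => b b0; rewrite mulr_ge0 //; lra.
  rewrite /C; move: (la2); move: (1 / (2 * la)) => b; lra.
apply: (@le_trans _ _ (- (e * (qx + dzz + dww)))); last first.
  rewrite mulNr lerN2 [leLHS]mulrAC ler_pdivrMr // -[leRHS]mulrA ler_pM2l //.
  by rewrite [leRHS]mulrC.
have f5 : (g1 + g2) / th * qw = g1 / th * qw + g2 / th * qw by rewrite mulrDl mulrDl.
have f6 : alpha * (la * dzz) = (k + 1) * dzz by rewrite /k; ring.
have f7 : (N - (g1 + g2) / th) * qw = N * qw - (g1 + g2) / th * qw by ring.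
rewrite f7 f5 in f3; rewrite f6 in f4.
move: f1 f2 f3 f4 sgn k1 k2; rewrite -/m -/N.
move: (g1 / th * qw) (g2 / th * qw) (alpha * qz) => G1 G2 aqz; lra.
Qed.

Lemma lyapunov_coercive : graph_connected E -> 1 < (2 * alpha - 1) * lambda_ 2 L ->
  exists2 c : R, 0 < c & forall x z w, c * (D x x + D z z + D w w) <= lyapunov x z w.
Proof.
move=> conn hq; have [] := laplacian_spectral_gap R n2 symE conn.
move: hq; set la := lambda_ 2 L; set q := _ * la => q1 la0 _ gap.
(* Any s strictly between 1 and q works. *)
pose s := (1 + q) / 2; have s1 : 1 < s by rewrite /s; lra.
have qs : s < q by rewrite /s; lra.
have si : s^-1 < 1 by rewrite invf_lt1 //; lra.
pose c := Num.min ((q - s) / 2) (Num.min ((1 - s^-1) / 2) 2^-1).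
exists c; first by rewrite !lt_min; apply/and3P; split; lra.
move=> x z w.
have D_ge0 i j : 0 <= mean_weight R n i j.
  by rewrite mxE invr_ge0 mulr_ge0 // ler0n.
have xz := difference_form_quad x z s 1 D_ge0.
have xx := difference_form_ge0 x D_ge0.
have zz := difference_form_ge0 z D_ge0.
have ww := difference_form_ge0 w D_ge0.
have c1 : c <= (q - s) / 2 by rewrite ge_min lexx.
have c2 : c <= (1 - s^-1) / 2 by rewrite !ge_min lexx orbT.
have c3 : c <= 2^-1 by rewrite !ge_min lexx !orbT.
have a0 : 0 <= 2 * alpha - 1.
  by rewrite -(pmulr_lge0 _ la0) -/q; lra.
have gx : q * D x x <= (2 * alpha - 1) * Q x x.
  by rewrite /q -mulrA ler_wpM2l.
rewrite /lyapunov; move: xz xx zz ww gx.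
move: (Q x x) (D x z) (D w w) (D z z) (D x x) => qx dxz dw dz dx xz xx zz ww gx.
have : 0 <= s * dx + 2 * dxz + s^-1 * dz.
  have s0 : 0 < s by lra.
  rewrite -(pmulr_rge0 _ s0); apply: le_trans xz _.
  by rewrite le_eqVlt; apply/orP; left; apply/eqP; field; lra.
have : c * dx <= (q - s) / 2 * dx by rewrite ler_wpM2r.
have : c * dz <= (1 - s^-1) / 2 * dz by rewrite ler_wpM2r.
have : c * dw <= 2^-1 * dw by rewrite ler_wpM2r.
lra.
Qed.

End Lyapunov.

(** The gain condition implies the one needed for the decay of [V]; only
    [0 < l2 <= ln] is used of the largest eigenvalue. *)
Lemma gain_condition (R : realFieldType) (alpha beta l2 ln : R) :
  0 < l2 -> l2 <= ln -> 1 < alpha -> 1 < alpha * l2 ->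
  (1 + alpha ^+ 4 * ln ^+ 2) / (4 * l2 * (alpha * l2 - 1) * (alpha - 1)) < beta ->
  (2 - alpha) ^+ 2 / (4 * (alpha - 1)) + 1 / (4 * l2 * (alpha * l2 - 1))
    < beta - alpha.
Proof.
move=> l20 l2n a1 al1 hb.
set m := alpha - 1; set k := alpha * l2 - 1 in hb *.
have m0 : 0 < m by rewrite subr_gt0.
have k0 : 0 < k by rewrite subr_gt0.
have P0 : 0 < 4 * l2 * k * m by apply: mulr_gt0 => //; apply: mulr_gt0 => //; apply: mulr_gt0.
rewrite ltrBrDr; apply: le_lt_trans hb; rewrite -/m ler_pdivlMr //.
have -> : ((2 - alpha) ^+ 2 / (4 * m) + 1 / (4 * l2 * k) + alpha) * (4 * l2 * k * m) =
    (2 - alpha) ^+ 2 * (l2 * k) + m + alpha * (4 * l2 * k * m).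
  by field; rewrite !gt_eqF.
(* The largest eigenvalue is first replaced by the smaller l2; the difference
   of the two sides is then a sum of two nonnegative terms, the second one
   because alpha * l2 > 1. *)
apply: (@le_trans _ _ (1 + alpha ^+ 4 * l2 ^+ 2)); last first.
  rewrite lerD2l ler_wpM2l ?exprn_ge0 ?(ltW (lt_trans ltr01 a1)) //.
  by rewrite ler_pXn2r // nnegrE ltW // (lt_le_trans l20).
rewrite -subr_ge0.
have -> : 1 + alpha ^+ 4 * l2 ^+ 2 - ((2 - alpha) ^+ 2 * (l2 * k) + m + alpha * (4 * l2 * k * m))
  = alpha * l2 ^+ 2 * (m * (alpha - 2) ^+ 2)
    + (l2 * (5 * alpha ^+ 2 - 8 * alpha + 4) - (alpha - 2)).
  rewrite /m /k; ring.
apply: addr_ge0.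
  apply: mulr_ge0; apply: mulr_ge0; rewrite ?sqr_ge0 // ltW //.
  exact: lt_trans ltr01 a1.
have a0 : 0 < alpha by lra.
rewrite -(pmulr_rge0 _ a0) mulrBr mulrA.
have A0 : 0 <= 5 * alpha ^+ 2 - 8 * alpha + 4 by nra.
have : 5 * alpha ^+ 2 - 8 * alpha + 4 <= alpha * l2 * (5 * alpha ^+ 2 - 8 * alpha + 4).
  by rewrite ler_peMl // ltW.
nra.
Qed.

(** * Linear functionals and Filippov velocities *)

Section ScalarFunctional.
Variables (R : realType) (m k : nat).
Local Notation M := 'M[R]_(m, k).
Implicit Types l : M -> R.

Lemma scalarD l u v : scalar l -> l (u + v) = l u + l v.
Proof. by move=> hl; rewrite -[u]scale1r hl mul1r scale1r. Qed.

Lemma scalar0 l : scalar l -> l 0 = 0.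
Proof. by move=> hl; have := scalarD 0 0 hl; rewrite addr0; lra. Qed.

Lemma scalarZ l a u : scalar l -> l (a *: u) = a * l u.
Proof. by move=> hl; rewrite -[a *: u]addr0 hl scalar0 // addr0. Qed.

Lemma scalar_coord l y : scalar l ->
  l y = \sum_i \sum_j l (delta_mx i j) * y i j.
Proof.
move=> hl; have lsum (I : Type) (s : seq I) (F : I -> M) :
    l (\sum_(i <- s) F i) = \sum_(i <- s) l (F i).
  apply: (big_morph l); last exact: scalar0.
  by move=> u v; apply: scalarD.
rewrite {1}[y]matrix_sum_delta lsum; apply: eq_bigr => i _.
by rewrite lsum; apply: eq_bigr => j _; rewrite scalarZ // mulrC.
Qed.

Lemma cvg_sumr (T : Type) (F : set_system T) {FF : Filter F} (I : Type) (s : seq I)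
    (f : I -> T -> R) (a : I -> R) :
  (forall i, f i x @[x --> F] --> a i) ->
  \sum_(i <- s) f i x @[x --> F] --> \sum_(i <- s) a i.
Proof.
move=> fa; elim: s => [|i s IH].
  rewrite big_nil; under eq_fun do rewrite big_nil; exact: cvg_cst.
by rewrite big_cons; under eq_fun do rewrite big_cons; apply: cvgD.
Qed.

Lemma scalar_continuous l : scalar l -> continuous l.
Proof.
move=> hl y.
have e : (fun u : M => \sum_i \sum_j l (delta_mx i j) * u i j) = l.
  by apply/funext => u; rewrite -scalar_coord.
have : (fun u : M => \sum_i \sum_j l (delta_mx i j) * u i j) @ y --> l y.
  rewrite scalar_coord //.
  apply: (@cvg_sumr _ (nbhs y) (nbhs_filter y)) => i.
  apply: (@cvg_sumr _ (nbhs y) (nbhs_filter y)) => j.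
  apply: cvgM; first exact: cvg_cst.
  exact: coord_continuous.
by rewrite e.
Qed.

Lemma is_derive_sumr (I : Type) (s : seq I) (f : I -> R -> R) (t : R) (df : I -> R) :
  (forall i, is_derive t (1 : R) (f i) (df i)) ->
  is_derive t (1 : R) (fun x => \sum_(i <- s) f i x) (\sum_(i <- s) df i).
Proof.
move=> h; elim: s => [|i s IH].
  rewrite big_nil; under eq_fun do rewrite big_nil; exact: is_derive_cst.
by rewrite big_cons; under eq_fun do rewrite big_cons; apply: is_deriveD.
Qed.

Lemma is_derive_addr (f g : R -> R) (t df dg : R) :
  is_derive t (1 : R) f df -> is_derive t (1 : R) g dg ->
  is_derive t (1 : R) (fun x => f x + g x) (df + dg).
Proof. exact: is_deriveD. Qed.

Lemma is_derive_mulr (f g : R -> R) (t df dg : R) :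
  is_derive t (1 : R) f df -> is_derive t (1 : R) g dg ->
  is_derive t (1 : R) (fun x => f x * g x) (df * g t + f t * dg).
Proof.
move=> hf hg; apply: is_derive_eq (is_deriveM hf hg) _.
by rewrite /GRing.scale /= addrC mulrC.
Qed.

Lemma is_derive_mulr_cst (c : R) (f : R -> R) (t df : R) :
  is_derive t (1 : R) f df -> is_derive t (1 : R) (fun x => c * f x) (c * df).
Proof.
move=> hf; apply: is_derive_eq (is_derive_mulr (is_derive_cst c t 1) hf) _.
by rewrite mul0r add0r.
Qed.

Lemma scalar_is_derive l (y : R -> M) t (dy : M) : scalar l ->
  (forall i j, is_derive t (1 : R) (fun s => y s i j) (dy i j)) ->
  is_derive t (1 : R) (fun s => l (y s)) (l dy).
Proof.
move=> hl hy; rewrite [l dy]scalar_coord //.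
under eq_fun do rewrite scalar_coord //.
by apply: is_derive_sumr => i; apply: is_derive_sumr => j.
Qed.

Lemma scalar_abs_continuous l (y : R -> M) a b : scalar l ->
  (forall i j, abs_continuous a b (fun s => y s i j)) ->
  abs_continuous a b (fun s => l (y s)).
Proof.
move=> hl hy; rewrite (_ : (fun s => _) =
    (fun s => \sum_i \sum_j l (delta_mx i j) * y s i j)).
  apply: abs_continuous_sum => i; apply: abs_continuous_sum => j.
  exact: abs_continuousZ.
by apply/funext => s; apply: scalar_coord.
Qed.

(** Both dimensions must be positive: an empty product of side lengths is [1]. *)
Lemma lebesgue_null0 : (0 < m)%N -> (0 < k)%N -> lebesgue_null (set0 : set M).
Proof.
move=> m0 k0 e e0; exists (fun=> 0), (fun=> 0); split => //.
move=> Q; rewrite big1; first exact: ltW.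
move=> q _; rewrite (bigD1 (Ordinal m0)) //= (bigD1 (Ordinal k0)) //=.
by rewrite subrr !mul0r.
Qed.

(** Half-spaces are closed and convex, so a bound on [l] over the values of [f]
    near [z] passes to the Filippov velocities at [z]. *)
Lemma filippov_scalar_le (f : R -> M -> M) t z (dy : M) l c : (0 < m)%N -> (0 < k)%N ->
  scalar l -> filippov f t z dy -> (\forall u \near z, l (f t u) <= c) -> l dy <= c.
Proof.
move=> m0 k0 hl hdy /nbhs_ballP[d /= d0 hd].
apply: (hdy d d0 set0 (lebesgue_null0 m0 k0) [set y | l y <= c]); split.
- apply: (preimage_closed (f := l) (D := [set x | x <= c])); last exact: closed_le.
  by move=> y _; apply: scalar_continuous.
- move=> u v p; rewrite !inE /= => hu hv.
  rewrite /conv /= scalarD // !scalarZ //.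
  have -> : c = p%:num * c + (1 - p%:num) * c by ring.
  apply: lerD; apply: ler_wpM2l => //.
  by rewrite unstable.onem_ge0 ?le1.
- by move=> _ [u [zu _] <-]; apply: hd.
Qed.

(** A functional of [f] that happens to be continuous at [z] takes its nominal
    value on every Filippov velocity. *)
Lemma filippov_scalar_eq (f : R -> M -> M) t z (dy : M) l : (0 < m)%N -> (0 < k)%N ->
  scalar l -> filippov f t z dy -> l (f t u) @[u --> z] --> l (f t z) ->
  l dy = l (f t z).
Proof.
move=> m0 k0 hl hdy lf.
have near_e e : 0 < e -> \forall u \near z, `|l (f t z) - l (f t u)| <= e.
  by move=> e0; move/cvgrPdist_le : lf => /(_ _ e0).
apply/eqP; rewrite eq_le; apply/andP; split.
  apply/ler_addgt0Pr => e e0; apply: (filippov_scalar_le _ _ hl hdy) => //.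
  by apply: filterS (near_e _ e0) => u; rewrite ler_norml => /andP[]; lra.
have hN : scalar (fun y => - l y) by move=> a u v; rewrite hl; ring.
rewrite -lerN2; apply/ler_addgt0Pr => e e0.
apply: (filippov_scalar_le _ _ hN hdy) => //.
by apply: filterS (near_e _ e0) => u; rewrite ler_norml => /andP[]; lra.
Qed.

End ScalarFunctional.

(** * One coordinate of the closed loop *)

Section Columns.
Variables (R : realType) (n p : nat) (E : rel 'I_n) (alpha beta gamma : R) (q : 'I_p).
Local Notation S := 'M[R]_(n, p + p + p).
Local Notation L := (laplacian R E).
Implicit Types y z : S.

(** The positions, the velocities and the filter outputs of the agents in the
    coordinate [q], as linear functions of the state. *)
Definition position_column z : 'cV[R]_n := col q (lsubmx (lsubmx z)).
Definition velocity_column z : 'cV[R]_n := col q (rsubmx (lsubmx z)).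
Definition filter_column z : 'cV[R]_n :=
  col q (rsubmx z) - alpha *: (L *m position_column z).

Lemma position_columnP a y z :
  position_column (a *: y + z) = a *: position_column y + position_column z.
Proof. by rewrite /position_column !linearP. Qed.

Lemma velocity_columnP a y z :
  velocity_column (a *: y + z) = a *: velocity_column y + velocity_column z.
Proof. by rewrite /velocity_column !linearP. Qed.

Lemma filter_columnP a y z :
  filter_column (a *: y + z) = a *: filter_column y + filter_column z.
Proof.
rewrite /filter_column position_columnP mulmxDr -scalemxAr !linearP /=.
apply/matrixP => i j; rewrite !mxE; ring.
Qed.

Definition columnP := (position_columnP, velocity_columnP, filter_columnP).

Lemma neighbors_sum_rows (x : 'M[R]_(n, p)) i :
  (\sum_(j in neighbors E i) (row i x - row j x)) 0 q = (L *m col q x) i 0.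
Proof.
rewrite neighbors_sum summxE laplacian_mulE.
by apply: eq_bigr => j _; rewrite !mxE.
Qed.

Lemma neighbors_sum_signs (w : 'M[R]_(n, p)) i :
  (\sum_(j in neighbors E i) sgnv (row i w - row j w)) 0 q
    = sign_flow E (col q w) i 0.
Proof. by rewrite summxE mxE; apply: eq_bigr => j _; rewrite !mxE. Qed.

Lemma col_filter_output z :
  col q (filter_output E alpha (lsubmx (lsubmx z)) (rsubmx z)) = filter_column z.
Proof.
apply/colP => i; rewrite mxE mxE [in LHS]mxE [X in _ + X]mxE [X in - X]mxE.
by rewrite neighbors_sum_rows !mxE.
Qed.

Lemma position_column_closed_loop (ar : R -> 'M[R]_(n, p)) t z :
  position_column (closed_loop E alpha beta gamma ar t z) = velocity_column z.
Proof. by rewrite /position_column /closed_loop /state !row_mxKl. Qed.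

Lemma velocity_column_closed_loop (ar : R -> 'M[R]_(n, p)) t z :
  velocity_column (closed_loop E alpha beta gamma ar t z) =
    column_control E alpha beta gamma (position_column z) (filter_column z)
      (col q (ar t)).
Proof.
rewrite /velocity_column /closed_loop /state row_mxKl row_mxKr -col_filter_output.
set w := filter_output _ _ _ _; apply/colP => i.
have e (a b c d : 'cV[R]_n) : (- alpha *: a + beta *: b + gamma *: c + d) i 0 =
    - alpha * a i 0 + beta * b i 0 + gamma * c i 0 + d i 0 by rewrite !mxE.
rewrite /column_control e /position_column -!neighbors_sum_rows.
by rewrite -neighbors_sum_signs !mxE.
Qed.

Lemma filter_column_closed_loop (ar : R -> 'M[R]_(n, p)) t z :
  filter_column (closed_loop E alpha beta gamma ar t z) =
    column_filter_rate E beta gamma (position_column z) (filter_column z)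
      (col q (ar t)) - alpha *: (L *m velocity_column z).
Proof.
rewrite {1}/filter_column position_column_closed_loop; congr (_ - _).
rewrite /closed_loop /state row_mxKr -col_filter_output.
set w := filter_output _ _ _ _; apply/colP => i.
have e (a b c d : 'cV[R]_n) : (a - beta *: b - gamma *: c - d) i 0 =
    a i 0 - beta * b i 0 - gamma * c i 0 - d i 0 by rewrite !mxE.
rewrite /column_filter_rate e /position_column -!neighbors_sum_rows.
by rewrite -neighbors_sum_signs !mxE.
Qed.

(** Derivative of [V] at the state [y] in the direction [dy]. *)
Definition lyapunov_gradient y dy : R :=
  lyapunov_derivative E alpha
    (position_column y) (velocity_column y + filter_column y) (filter_column y)
    (position_column dy) (velocity_column dy + filter_column dy) (filter_column dy).

Lemma lyapunov_gradient_scalar y : scalar (lyapunov_gradient y).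
Proof.
move=> a u v; rewrite /lyapunov_gradient !columnP /lyapunov_derivative.
by rewrite !difference_formE; ring.
Qed.

Lemma lyapunov_gradient_closed_loop (ar : R -> 'M[R]_(n, p)) t y z :
  lyapunov_gradient y (closed_loop E alpha beta gamma ar t z) =
  lyapunov_derivative E alpha
    (position_column y) (velocity_column y + filter_column y) (filter_column y)
    (velocity_column z)
    (column_control E alpha beta gamma (position_column z) (filter_column z)
      (col q (ar t)) + (column_filter_rate E beta gamma (position_column z)
      (filter_column z) (col q (ar t)) - alpha *: (L *m velocity_column z)))
    (column_filter_rate E beta gamma (position_column z) (filter_column z)
      (col q (ar t)) - alpha *: (L *m velocity_column z)).
Proof.
by rewrite /lyapunov_gradient position_column_closed_loop
  velocity_column_closed_loop filter_column_closed_loop.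
Qed.

(** The jump of the sign at [0] is killed by the factor [u y]. *)
Lemma sg_continuous_at (T : topologicalType) (u : T -> R) (y : T) :
  u x @[x --> y] --> u y -> (u y * Num.sg (u x)) @[x --> y] --> u y * Num.sg (u y).
Proof.
move=> uy; apply: cvg_near_cst.
have [->|u0] := eqVneq (u y) 0; first by apply: nearW => x; rewrite !mul0r.
have nu0 : 0 < `|u y| by rewrite normr_gt0.
move/cvgrPdist_lt : uy => /(_ _ nu0); apply: filterS => x h.
congr (_ * _); have [yp|yn] := ltP 0 (u y).
  by rewrite !gtr0_sg //; move: h; rewrite (gtr0_norm yp) ltr_norml => /andP[]; lra.
have yn' : u y < 0 by rewrite lt_neqAle u0.
by rewrite !ltr0_sg //; move: h; rewrite (ltr0_norm yn') ltr_norml => /andP[]; lra.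
Qed.

(** With [y] frozen in the gradient, the sign terms appear as
    [(w_i - w_j) sg (w'_i - w'_j)], where [w'] belongs to the nearby state [z]. *)
Lemma lyapunov_gradient_closed_loop_cvg (ar : R -> 'M[R]_(n, p)) t y :
  (2 <= n)%N -> symmetric E ->
  lyapunov_gradient y (closed_loop E alpha beta gamma ar t z) @[z --> y]
    --> lyapunov_gradient y (closed_loop E alpha beta gamma ar t y).
Proof.
move=> n2 symE; have n0 : (0 < n)%N by exact: ltnW.
pose l (x s w : 'cV[R]_n) (z : S) : R :=
  (2 * alpha - 1) * edge_form E x (velocity_column z)
  + mean_form s (velocity_column z)
  + mean_form (x + s) (- (alpha - 1) *: (L *m position_column z)
      - alpha *: (L *m velocity_column z))
  + mean_form w (L *m position_column z - beta *: (L *m filter_column z)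
      - alpha *: (L *m velocity_column z)).
have l_scalar x s w : scalar (l x s w).
  move=> a u v; rewrite /l !columnP.
  move: (position_column u) (velocity_column u) (filter_column u) => xu vu wu.
  move: (position_column v) (velocity_column v) (filter_column v) => xv vv wv.
  by rewrite !mulmxDr -!scalemxAr !difference_formE; ring.
set x := position_column y; set w := filter_column y.
set s := velocity_column y + w.
pose sgn (z : S) : R := \sum_i \sum_j 2^-1 *
  ((w i 0 - w j 0) * (adjacency R E i j *
    Num.sg (filter_column z i 0 - filter_column z j 0))).
have e z : lyapunov_gradient y (closed_loop E alpha beta gamma ar t z) =
    l x s w z - mean_form w (col q (ar t)) - gamma * sgn z.
  rewrite lyapunov_gradient_closed_loop /sgn -mean_form_sign_flow //.
  set dv := column_control _ _ _ _ _ _ _; set dw := _ - alpha *: _.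
  have -> : dv + dw = - (alpha - 1) *: (L *m position_column z)
      - alpha *: (L *m velocity_column z).
    rewrite /dv /dw /column_control /column_filter_rate; apply/matrixP => i j.
    rewrite !mxE; ring.
  rewrite /l /lyapunov_derivative -/x -/w -/s /dw /column_filter_rate.
  clearbody x w s; rewrite !difference_formE [mean_form _ s]difference_formC.
  ring.
have l_cvg : l x s w @ y --> l x s w y by apply: scalar_continuous.
have sgn_cvg : sgn @ y --> sgn y.
  apply: (@cvg_sumr _ _ (nbhs y) (nbhs_filter y)) => i.
  apply: (@cvg_sumr _ _ (nbhs y) (nbhs_filter y)) => j.
  apply: cvgM; first exact: cvg_cst.
  under eq_fun do rewrite mulrCA; rewrite mulrCA.
  apply: cvgM; first exact: cvg_cst.
  apply: (@sg_continuous_at _ (fun z : S => filter_column z i 0 - filter_column z j 0)).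
  apply: (@scalar_continuous _ _ _ (fun z : S => filter_column z i 0 - filter_column z j 0)).
  by move=> a u v; rewrite filter_columnP; move: (filter_column u) (filter_column v) => wu wv;
    rewrite !mxE; ring.
under eq_fun do rewrite e; rewrite e.
have FF := nbhs_filter y.
exact: (cvgB (cvgB l_cvg (cvg_cst _)) (cvgM (cvg_cst _) sgn_cvg)).
Qed.

Lemma sum_position_scalar : scalar (fun z : S => \sum_i position_column z i 0).
Proof.
move=> a u v; rewrite mulr_sumr -big_split; apply: eq_bigr => i _ /=.
by rewrite position_columnP !mxE.
Qed.

Lemma sum_velocity_scalar : scalar (fun z : S => \sum_i velocity_column z i 0).
Proof.
move=> a u v; rewrite mulr_sumr -big_split; apply: eq_bigr => i _ /=.
by rewrite velocity_columnP !mxE.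
Qed.

Lemma sum_velocity_closed_loop (ar : R -> 'M[R]_(n, p)) t z : symmetric E ->
  \sum_i velocity_column (closed_loop E alpha beta gamma ar t z) i 0
    = \sum_i ar t i q.
Proof.
move=> symE; rewrite velocity_column_closed_loop /column_control.
set x := position_column z; set w := filter_column z.
transitivity (- alpha * \sum_i (L *m x) i 0 + beta * \sum_i (L *m w) i 0
   + gamma * \sum_i sign_flow E w i 0 + \sum_i ar t i q).
  rewrite !mulr_sumr -!big_split; apply: eq_bigr => i _ /=.
  by rewrite mxE [X in X + _ = _]mxE [X in X + _ + _ = _]mxE
     [X in X + _ + _ + _ = _]mxE [X in _ + X + _ + _ = _]mxE
     [X in _ + X + _ = _]mxE [X in _ + X = _]mxE.
by rewrite !laplacian_sum0 // sign_flow_sum0 // !mulr0 !add0r.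
Qed.

End Columns.

Lemma difference_form_is_derive (R : realType) (n : nat) (m : 'M[R]_n)
    (f g : R -> 'cV[R]_n) (t : R) (df dg : 'cV[R]_n) :
  (forall i, is_derive t (1 : R) (fun s => f s i 0) (df i 0)) ->
  (forall i, is_derive t (1 : R) (fun s => g s i 0) (dg i 0)) ->
  is_derive t (1 : R) (fun s => difference_form m (f s) (g s))
    (difference_form m df (g t) + difference_form m (f t) dg).
Proof.
move=> hf hg.
have -> : difference_form m df (g t) + difference_form m (f t) dg =
    \sum_i \sum_j m i j * ((df i 0 - df j 0) * (g t i 0 - g t j 0)
                           + (f t i 0 - f t j 0) * (dg i 0 - dg j 0)).
  rewrite -big_split; apply: eq_bigr => i _; rewrite -big_split.
  by apply: eq_bigr => j _; rewrite /= [RHS]mulrDr.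
apply: is_derive_sumr => i; apply: is_derive_sumr => j.
apply: is_derive_mulr_cst; apply: is_derive_mulr; exact: is_deriveB.
Qed.

Lemma difference_form_abs_continuous (R : realType) (n : nat) (m : 'M[R]_n)
    (f g : R -> 'cV[R]_n) (a b : R) :
  (forall i, abs_continuous a b (fun s => f s i 0)) ->
  (forall i, abs_continuous a b (fun s => g s i 0)) ->
  abs_continuous a b (fun s => difference_form m (f s) (g s)).
Proof.
move=> hf hg; apply: abs_continuous_sum => i; apply: abs_continuous_sum => j.
by apply: abs_continuousZ; apply: abs_continuousM; apply: abs_continuousB.
Qed.

Lemma lyapunov_is_derive (R : realType) (n : nat) (E : rel 'I_n) (alpha : R)
    (x z w : R -> 'cV[R]_n) (t : R) (dx dz dw : 'cV[R]_n) :
  (forall i, is_derive t (1 : R) (fun s => x s i 0) (dx i 0)) ->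
  (forall i, is_derive t (1 : R) (fun s => z s i 0) (dz i 0)) ->
  (forall i, is_derive t (1 : R) (fun s => w s i 0) (dw i 0)) ->
  is_derive t (1 : R) (fun s => lyapunov E alpha (x s) (z s) (w s))
    (lyapunov_derivative E alpha (x t) (z t) (w t) dx dz dw).
Proof.
move=> hx hz hw.
have xx := difference_form_is_derive (edge_weight R E) hx hx.
have xz := difference_form_is_derive (mean_weight R n) hx hz.
have zz := difference_form_is_derive (mean_weight R n) hz hz.
have ww := difference_form_is_derive (mean_weight R n) hw hw.
have hl := is_derive_addr (is_derive_addr (is_derive_addr
    (is_derive_mulr_cst ((2 * alpha - 1) / 2) xx) xz)
    (is_derive_mulr_cst 2^-1 zz)) (is_derive_mulr_cst 2^-1 ww).
apply: is_derive_eq hl _.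
rewrite /lyapunov_derivative [edge_form E dx _]difference_formC.
rewrite [mean_form dz (z t)]difference_formC [mean_form dw (w t)]difference_formC.
by field.
Qed.

Lemma lyapunov_abs_continuous (R : realType) (n : nat) (E : rel 'I_n) (alpha : R)
    (x z w : R -> 'cV[R]_n) (a b : R) :
  (forall i, abs_continuous a b (fun s => x s i 0)) ->
  (forall i, abs_continuous a b (fun s => z s i 0)) ->
  (forall i, abs_continuous a b (fun s => w s i 0)) ->
  abs_continuous a b (fun s => lyapunov E alpha (x s) (z s) (w s)).
Proof.
move=> hx hz hw; rewrite /lyapunov.
by apply: abs_continuousD; [apply: abs_continuousD; [apply: abs_continuousD|]|];
  try apply: abs_continuousZ; apply: difference_form_abs_continuous.
Qed.

(** * Tracking *)

(** Monotonicity of almost everywhere statements, for Lebesgue measure. *)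
Lemma ae_imply2 (R : realType) (P Q S : R -> Prop) :
  (forall t, P t -> Q t -> S t) ->
  {ae (@lebesgue_measure R), forall t, P t} ->
  {ae (@lebesgue_measure R), forall t, Q t} ->
  {ae (@lebesgue_measure R), forall t, S t}.
Proof.
move=> PQS aeP aeQ.
have FA := ae_filter_ringOfSetsType (@lebesgue_measure R).
exact: (@filterS2 _ _ FA _ _ _ PQS aeP aeQ).
Qed.

Lemma ae_imply (R : realType) (P S : R -> Prop) :
  (forall t, P t -> S t) ->
  {ae (@lebesgue_measure R), forall t, P t} ->
  {ae (@lebesgue_measure R), forall t, S t}.
Proof. by move=> PS aeP; apply: (ae_imply2 _ aeP aeP) => t Pt _; apply: PS. Qed.

Lemma abs_continuous_constant (R : realType) (g : R -> R) (t : R) : 0 <= t ->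
  (forall T, 0 < T -> abs_continuous 0 T g) ->
  {ae (@lebesgue_measure R), forall s : R, 0 < s -> is_derive s (1 : R) g 0} ->
  g t = g 0.
Proof.
rewrite le_eqVlt => /orP[/eqP <- //|t0] acg dg.
apply/eqP; rewrite eq_le; apply/andP; split.
  apply: abs_continuous_nonincreasing (acg _ t0) _ => //.
  by apply: (ae_imply _ dg) => s hs s0; exists 0 => //; apply: hs.
rewrite -lerN2; apply: (@abs_continuous_nonincreasing _ _ (fun s => - g s)) => //.
  by apply: abs_continuousN; apply: acg.
apply: (ae_imply _ dg) => s hs s0; exists 0 => //.
by apply: is_derive_eq (is_deriveN (hs s0)) _; rewrite oppr0.
Qed.

(** Decay of [f ^ 2] like [1 / (1 + c t)] is enough for convergence. *)
Lemma cvg0_of_decay (R : realType) (f : R -> R) (c C : R) : 0 < c ->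
  (forall t, 0 <= t -> (1 + c * t) * f t ^+ 2 <= C) ->
  f t @[t --> +oo] --> (0 : R).
Proof.
move=> c0 hf; apply/cvgrPdist_le => e e0.
have ce : 0 < c * e ^+ 2 by rewrite mulr_gt0 // exprn_gt0.
near=> t.
have t0 : 0 <= t by near: t; apply: nbhs_pinfty_ge; rewrite num_real.
have tC : C / (c * e ^+ 2) <= t by near: t; apply: nbhs_pinfty_ge; rewrite num_real.
rewrite sub0r normrN -(ler_pXn2r (n := 2)) // ?nnegrE ?(ltW e0) //.
rewrite real_normK ?num_real //.
have ct : 0 < 1 + c * t by rewrite ltr_pwDl // mulr_ge0 // ltW.
rewrite -(ler_pM2l ct); apply: le_trans (hf _ t0) _.
move: tC; rewrite ler_pdivrMr // => /le_trans; apply.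
rewrite mulrDl mul1r; have : 0 < e ^+ 2 by rewrite exprn_gt0.
lra.
Unshelve. all: by end_near. Qed.

Lemma norm2_cvg0 (R : realType) (p : nat) (u : R -> 'rV[R]_p) :
  (forall k, u t 0 k @[t --> +oo] --> (0 : R)) -> norm2 (u t) @[t --> +oo] --> (0 : R).
Proof.
move=> hu; have <- : Num.sqrt (\sum_(k < p) (0 : R)) = 0 by rewrite big1 // sqrtr0.
apply: (@continuous_cvg _ _ _ _ _ _ Num.sqrt); first exact: sqrt_continuous.
apply: cvg_sumr => k; rewrite -[X in _ --> X](mulr0 (0 : R)).
under eq_fun do rewrite expr2.
by apply: cvgM.
Qed.

Lemma norm2_coord (R : realType) (p : nat) (u : 'rV[R]_p) k : `|u 0 k| <= norm2 u.
Proof.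
rewrite -sqrtr_sqr ler_wsqrtr // (bigD1 k) //= lerDl.
by apply: sumr_ge0 => j _; rewrite sqr_ge0.
Qed.

Lemma scalar_rate_eq (R : realType) (m k : nat) (f : 'M[R]_(m, k) -> 'M[R]_(m, k))
    (y dy : 'M[R]_(m, k)) (l g : 'M[R]_(m, k) -> R) :
  (forall l : 'M[R]_(m, k) -> R, scalar l ->
     l (f u) @[u --> y] --> l (f y) -> l dy = l (f y)) ->
  scalar l -> (forall z, l (f z) = g z) -> continuous g -> l dy = g y.
Proof.
move=> H hl lg cg; rewrite H // lg.
by rewrite (_ : (fun u => _) = g); [exact: cg | apply/funext].
Qed.

Section Tracking.
Variables (R : realType) (n p : nat) (E : rel 'I_n) (alpha beta gamma : R).
Variables (ar x v ups : R -> 'M[R]_(n, p)).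
Local Notation y t := (state (x t) (v t) (ups t)).
Local Notation F := (closed_loop E alpha beta gamma ar).

(** What both notions of solution have in common: almost everywhere there is a
    velocity on which the functionals continuous along the vector field take
    their nominal values. *)
Lemma trajectory_rate : (0 < n)%N -> (0 < p)%N ->
  trajectory E alpha beta gamma ar x v ups ->
  (forall T i j, 0 < T -> abs_continuous 0 T (fun s => (y s) i j)) /\
  {ae (@lebesgue_measure R), forall t : R, 0 < t ->
    exists2 dy : 'M[R]_(n, p + p + p),
      forall i j, is_derive t (1 : R) (fun s => (y s) i j) (dy i j) &
      forall l : 'M[R]_(n, p + p + p) -> R, scalar l ->
        l (F t u) @[u --> y t] --> l (F t (y t)) -> l dy = l (F t (y t))}.
Proof.
move=> n0 p0 [[acy dy]|[acy dy]]; split => //.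
  by apply: (ae_imply _ dy) => t h t0; have [dz -> hd] := h t0; exists (F t (y t)).
apply: (ae_imply _ dy) => t h t0; have [dz hdz hd] := h t0; exists dz => // l hl cl.
apply: (filippov_scalar_eq _ _ hl hdz cl) => //.
by rewrite addn_gt0 p0 orbT.
Qed.

Section Column.
Variable q : 'I_p.
Hypothesis n2 : (2 <= n)%N.
Hypothesis symE : symmetric E.
Hypothesis traj : trajectory E alpha beta gamma ar x v ups.

Let n0 : (0 < n)%N. Proof. exact: ltnW. Qed.
Let p0 : (0 < p)%N. Proof. exact: leq_ltn_trans (ltn_ord q). Qed.

Lemma position_column_state t : position_column q (y t) = col q (x t).
Proof. by rewrite /position_column /state !row_mxKl. Qed.

Lemma velocity_column_state t : velocity_column q (y t) = col q (v t).
Proof. by rewrite /velocity_column /state row_mxKl row_mxKr. Qed.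

(** The control inputs sum to the input accelerations, so the sums of the
    velocities, then of the positions, follow those of the inputs. *)
Lemma sum_tracking (r vr : R -> 'M[R]_(n, p)) :
  has_rate r vr -> has_rate vr ar ->
  \sum_i row i (x 0) = \sum_i row i (r 0) ->
  \sum_i row i (v 0) = \sum_i row i (vr 0) ->
  forall t, 0 <= t -> \sum_i x t i q = \sum_i r t i q /\
                      \sum_i v t i q = \sum_i vr t i q.
Proof.
move=> [acr dr] [acvr dvr] xr0 vvr0.
have [acy dy] := trajectory_rate n0 p0 traj.
have row0 (a b : 'M[R]_(n, p)) : \sum_i row i a = \sum_i row i b ->
    \sum_i a i q - \sum_i b i q = 0.
  move=> /rowP /(_ q); rewrite !summxE => e; apply/eqP; rewrite subr_eq0; apply/eqP.
  by move: e; under eq_bigr do rewrite mxE; under [in RHS]eq_bigr do rewrite mxE.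
have xcolE t : \sum_i x t i q = \sum_i position_column q (y t) i 0.
  by rewrite position_column_state; apply: eq_bigr => i _; rewrite mxE.
have vcolE t : \sum_i v t i q = \sum_i velocity_column q (y t) i 0.
  by rewrite velocity_column_state; apply: eq_bigr => i _; rewrite mxE.
have acx T : 0 < T -> abs_continuous 0 T (fun t => \sum_i x t i q - \sum_i r t i q).
  move=> T0; have h1 := scalar_abs_continuous (y := fun t => y t)
    (@sum_position_scalar R n p q) (fun i j => acy T i j T0).
  have h2 : abs_continuous 0 T (fun t => \sum_i r t i q).
    by apply: abs_continuous_sum => i; apply: acr.
  have := abs_continuousB h1 h2; congr (abs_continuous 0 T _).
  by apply/funext => t; rewrite xcolE.
have acv T : 0 < T -> abs_continuous 0 T (fun t => \sum_i v t i q - \sum_i vr t i q).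
  move=> T0; have h1 := scalar_abs_continuous (y := fun t => y t)
    (@sum_velocity_scalar R n p q) (fun i j => acy T i j T0).
  have h2 : abs_continuous 0 T (fun t => \sum_i vr t i q).
    by apply: abs_continuous_sum => i; apply: acvr.
  have := abs_continuousB h1 h2; congr (abs_continuous 0 T _).
  by apply/funext => t; rewrite vcolE.
have hv t : 0 <= t -> \sum_i v t i q - \sum_i vr t i q = 0.
  move=> t0; rewrite -[RHS](row0 _ _ vvr0).
  apply: (@abs_continuous_constant _ (fun t => \sum_i v t i q - \sum_i vr t i q)) => //.
  apply: (ae_imply2 _ dy dvr) => s hy hr s0.
  have [dz dzy dzl] := hy s0; have [_ -> dvrs] := hr s0.
  have h1 := scalar_is_derive (y := fun t => y t) (@sum_velocity_scalar R n p q) dzy.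
  have h2 : is_derive s (1 : R) (fun t => \sum_i vr t i q) (\sum_i ar s i q).
    by apply: is_derive_sumr => i; apply: dvrs.
  rewrite (_ : (fun t => _) = (fun t => \sum_i velocity_column q (y t) i 0)
      - (fun t => \sum_i vr t i q)); last first.
    by apply/funext => t'; rewrite vcolE.
  apply: is_derive_eq (is_deriveB h1 h2) _.
  have e z : \sum_i velocity_column q (F s z) i 0 = \sum_i ar s i q.
    exact: (sum_velocity_closed_loop alpha beta gamma q ar s z symE).
  have := scalar_rate_eq dzl (@sum_velocity_scalar R n p q) e.
  by move=> ->; [rewrite subrr | exact: cst_continuous].
have hx t : 0 <= t -> \sum_i x t i q - \sum_i r t i q = 0.
  move=> t0; rewrite -[RHS](row0 _ _ xr0).
  apply: (@abs_continuous_constant _ (fun t => \sum_i x t i q - \sum_i r t i q)) => //.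
  apply: (ae_imply2 _ dy dr) => s hy hr s0.
  have [dz dzy dzl] := hy s0; have [_ -> drs] := hr s0.
  have h1 := scalar_is_derive (y := fun t => y t) (@sum_position_scalar R n p q) dzy.
  have h2 : is_derive s (1 : R) (fun t => \sum_i r t i q) (\sum_i vr s i q).
    by apply: is_derive_sumr => i; apply: drs.
  rewrite (_ : (fun t => _) = (fun t => \sum_i position_column q (y t) i 0)
      - (fun t => \sum_i r t i q)); last first.
    by apply/funext => t'; rewrite xcolE.
  apply: is_derive_eq (is_deriveB h1 h2) _.
  have e z : \sum_i position_column q (F s z) i 0 = \sum_i velocity_column q z i 0.
    by apply: eq_bigr => i _; rewrite position_column_closed_loop.
  have := scalar_rate_eq dzl (@sum_position_scalar R n p q) e.
  move=> ->; last exact: (scalar_continuous (@sum_velocity_scalar R n p q)).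
  by rewrite -vcolE; apply: hv; apply: ltW.
move=> t t0; split; apply/eqP; rewrite -subr_eq0; apply/eqP; [exact: hx|exact: hv].
Qed.

(** In one coordinate, positions and velocities converge to their means. *)
Lemma column_decay (abar : R) : graph_connected E -> 0 <= abar ->
  (forall t, 0 <= t -> forall i j, `|ar t i q - ar t j q| <= abar) ->
  (n%:R - 1) * abar <= gamma -> 1 < alpha -> 1 < alpha * lambda_ 2 (laplacian R E) ->
  1 < (2 * alpha - 1) * lambda_ 2 (laplacian R E) ->
  (2 - alpha) ^+ 2 / (4 * (alpha - 1))
    + 1 / (4 * lambda_ 2 (laplacian R E) * (alpha * lambda_ 2 (laplacian R E) - 1))
    < beta - alpha ->
  forall i, (x t i q - n%:R^-1 * \sum_k x t k q) @[t --> +oo] --> (0 : R) /\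
            (v t i q - n%:R^-1 * \sum_k v t k q) @[t --> +oo] --> (0 : R).
Proof.
move=> conn abar0 har hg a1 al1 al2 hb i.
have [c c0 decay] := lyapunov_decay n2 symE conn abar0 hg a1 al1 hb.
have [k k0 coer] := lyapunov_coercive n2 symE conn al2.
have D_ge0 (f : 'cV[R]_n) : 0 <= mean_form f f.
  by apply: difference_form_ge0 => a b; rewrite mxE invr_ge0 mulr_ge0 // ler0n.
have lyap_ge0 (a b d : 'cV[R]_n) : 0 <= lyapunov E alpha a b d.
  by apply: le_trans (coer a b d); rewrite mulr_ge0 ?(ltW k0) // !addr_ge0.
have [acy dy] := trajectory_rate n0 p0 traj.
pose X t := position_column q (y t).
pose W t := filter_column E alpha q (y t).
pose Z t := velocity_column q (y t) + W t.
pose V t := lyapunov E alpha (X t) (Z t) (W t).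
have Xs j : scalar (fun z : 'M[R]_(n, p + p + p) => position_column q z j 0).
  by move=> a b d; rewrite position_columnP !mxE.
have Ws j : scalar (fun z : 'M[R]_(n, p + p + p) => filter_column E alpha q z j 0).
  move=> a b d; rewrite filter_columnP.
  by move: (filter_column _ _ _ b) (filter_column _ _ _ d) => *; rewrite !mxE.
have Zs j : scalar (fun z : 'M[R]_(n, p + p + p) =>
    (velocity_column q z + filter_column E alpha q z) j 0).
  move=> a b d; rewrite filter_columnP velocity_columnP.
  move: (filter_column _ _ _ b) (filter_column _ _ _ d) => *; rewrite !mxE; ring.
(* The weight 1 + c t turns the decay rate - c V into a nonincreasing function
   without using the exponential. *)
have Vt T : 0 <= T -> (1 + c * T) * V T <= V 0.
  rewrite le_eqVlt => /orP[/eqP <-|T0]; first by rewrite mulr0 addr0 mul1r.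
  have -> : V 0 = (1 + c * 0) * V 0 by rewrite mulr0 addr0 mul1r.
  apply: (@abs_continuous_nonincreasing _ _ (fun t => (1 + c * t) * V t)) => //.
    apply: abs_continuousM.
      apply: abs_continuousD; first exact: abs_continuous_cst.
      by apply: abs_continuousZ; exact: abs_continuous_id.
    apply: lyapunov_abs_continuous => j.
    - exact: (scalar_abs_continuous (y := fun t => y t) (Xs j) (fun a b => acy T a b T0)).
    - exact: (scalar_abs_continuous (y := fun t => y t) (Zs j) (fun a b => acy T a b T0)).
    - exact: (scalar_abs_continuous (y := fun t => y t) (Ws j) (fun a b => acy T a b T0)).
  apply: (ae_imply _ dy) => t hy t0; have [dz dzy dzl] := hy t0.
  have hV : is_derive t (1 : R) V (lyapunov_gradient E alpha q (y t) dz).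
    apply: lyapunov_is_derive => j.
    - exact: (scalar_is_derive (y := fun t => y t) (Xs j) dzy).
    - exact: (scalar_is_derive (y := fun t => y t) (Zs j) dzy).
    - exact: (scalar_is_derive (y := fun t => y t) (Ws j) dzy).
  rewrite (dzl _ (@lyapunov_gradient_scalar R n p E alpha q (y t))
    (@lyapunov_gradient_closed_loop_cvg R n p E alpha beta gamma q ar t (y t) n2 symE)) in hV.
  have hc : is_derive t (1 : R) (fun s : R => 1 + c * s) c.
    have h1 : is_derive t (1 : R) (fun=> 1 : R) 0 by exact: is_derive_cst.
    have h2 : is_derive t (1 : R) (fun s : R => s) 1 by exact: is_derive_id.
    apply: is_derive_eq (is_derive_addr h1 (is_derive_mulr_cst c h2)) _.
    by rewrite add0r mulr1.
  exists (c * V t + (1 + c * t) * lyapunov_gradient E alpha q (y t) (F t (y t))).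
    exact: is_derive_mulr.
  have le_rate : lyapunov_gradient E alpha q (y t) (F t (y t)) <= - c * V t.
    rewrite lyapunov_gradient_closed_loop; apply: decay => a b.
    by rewrite !mxE; apply: har; apply: ltW.
  have ct : 0 < 1 + c * t by rewrite ltr_pwDl // mulr_ge0 // ltW.
  have := ler_wpM2l (ltW ct) le_rate.
  have : 0 <= c * t * (c * V t).
    by apply: mulr_ge0; apply: mulr_ge0; rewrite ?lyap_ge0 ?(ltW c0) ?(ltW t0).
  lra.
have DX t : k * mean_form (X t) (X t) <= V t.
  apply: le_trans (coer _ _ _); rewrite ler_pM2l // -addrA lerDl; exact: addr_ge0.
have DZW t : k * (mean_form (Z t) (Z t) + mean_form (W t) (W t)) <= V t.
  apply: le_trans (coer _ _ _); rewrite ler_pM2l // -addrA lerDr; exact: D_ge0.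
split.
  apply: (@cvg0_of_decay _ _ c (V 0 / k)) => // t t0.
  rewrite ler_pdivlMr // -mulrA; apply: le_trans (Vt t t0).
  rewrite ler_pM2l; last by rewrite ltr_pwDl // mulr_ge0 // ltW.
  apply: le_trans (DX t); rewrite mulrC ler_pM2l // /X position_column_state.
  have := deviation_le_mean_form (col q (x t)) i; rewrite mxE.
  by under eq_bigr do rewrite mxE.
apply: (@cvg0_of_decay _ _ c (2 * (V 0 / k))) => // t t0.
rewrite mulrA ler_pdivlMr // -mulrA.
apply: (@le_trans _ _ (2 * ((1 + c * t) * V t))); last by rewrite ler_pM2l // Vt.
rewrite [leRHS]mulrCA ler_pM2l; last by rewrite ltr_pwDl // mulr_ge0 // ltW.
apply: (@le_trans _ _ (2 * (k * (mean_form (Z t) (Z t) + mean_form (W t) (W t)))));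
  last by rewrite ler_pM2l.
rewrite [leLHS]mulrC [leRHS]mulrCA ler_pM2l //.
have dZ := deviation_le_mean_form (Z t) i.
have dW := deviation_le_mean_form (W t) i.
have -> : v t i q - n%:R^-1 * \sum_j v t j q =
   (Z t i 0 - n%:R^-1 * \sum_j Z t j 0) - (W t i 0 - n%:R^-1 * \sum_j W t j 0).
  have vE j : v t j q = Z t j 0 - W t j 0.
    have -> : Z t j 0 = v t j q + W t j 0.
      rewrite /Z velocity_column_state; move: (W t) => d.
      by rewrite mxE [X in X + _]mxE.
    by rewrite addrK.
  under eq_bigr do rewrite vE.
  by rewrite vE sumrB; ring.
move: dZ dW; move: (Z t i 0 - _) (W t i 0 - _) => a b dZ dW.
have : 0 <= (a + b) ^+ 2 by rewrite sqr_ge0.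
have -> : (a - b) ^+ 2 = 2 * (a ^+ 2 + b ^+ 2) - (a + b) ^+ 2 by ring.
lra.
Qed.

End Column.
End Tracking.

Theorem theorem3p3 (R : realType) (n p : nat) (E : rel 'I_n)
    (alpha beta gamma abar : R)
    (r vr ar x v ups : R -> 'M[R]_(n, p)) :
  let L := laplacian R E in
  let lambda2 := lambda_ 2 L in
  let lambdan := lambda_ n L in
  (2 <= n)%N ->
  irreflexive E ->
  symmetric E ->
  0 < alpha -> 0 < beta -> 0 < gamma ->
  has_rate r vr ->
  has_rate vr ar ->
  trajectory E alpha beta gamma ar x v ups ->
  graph_connected E ->
  0 < abar ->
  (forall i j : 'I_n,
     (ereal_sup [set (norm2 (row i (ar t) - row j (ar t)))%:E
                | t in [set t : R | (0 <= t)%R]] <= abar%:E)%E) ->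
  \sum_i row i (x 0) = \sum_i row i (r 0) ->
  \sum_i row i (v 0) = \sum_i row i (vr 0) ->
  Num.max 1 (Num.max (1 / lambda2) ((lambda2 + 1) / (2 * lambda2))) < alpha ->
  (n%:R - 1) * abar < gamma ->
  (1 + alpha ^+ 4 * lambdan ^+ 2) / (4 * lambda2 * (alpha * lambda2 - 1) * (alpha - 1)) < beta ->
  forall i : 'I_n,
    (norm2 (row i (x t) - n%:R^-1 *: \sum_j row j (r t)) @[t --> +oo] --> (0 : R)) /\
    (norm2 (row i (v t) - n%:R^-1 *: \sum_j row j (vr t)) @[t --> +oo] --> (0 : R)).
Proof.
move=> L lambda2 lambdan n2 _ symE _ _ _ rvr vrar traj conn abar0 har x0 v0.
rewrite !gt_max => /and3P[a1 al1 al2] hg hb i.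
have [l20 l2n _] := laplacian_spectral_gap R n2 symE conn.
have al1' : 1 < alpha * lambda2 by move: al1; rewrite ltr_pdivrMr.
have al2' : 1 < (2 * alpha - 1) * lambda2.
  by move: al2; rewrite ltr_pdivrMr ?mulr_gt0 //; lra.
have gain := gain_condition l20 l2n a1 al1' hb.
have har' q t : 0 <= t -> forall i j, `|ar t i q - ar t j q| <= abar.
  move=> t0 j k; have := norm2_coord (row j (ar t) - row k (ar t)) q.
  rewrite !mxE => /le_trans; apply; rewrite -lee_fin; apply: le_trans (har j k).
  by apply: ereal_sup_ubound; exists t.
have col q := column_decay n2 symE traj conn (ltW abar0) (har' q) (ltW hg)
  a1 al1' al2' gain i.
have sums q := sum_tracking q n2 symE traj rvr vrar x0 v0.
have near_ge0 (f g : R -> R) : (forall t, 0 <= t -> f t = g t) ->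
    f t @[t --> +oo] --> (0 : R) -> g t @[t --> +oo] --> (0 : R).
  move=> fg; apply: cvg_trans; apply: near_eq_cvg; near=> t.
  by rewrite fg //; near: t; apply: nbhs_pinfty_ge; rewrite num_real.
split; apply: norm2_cvg0 => q.
  apply: near_ge0 (col q).1 => t t0; rewrite (sums q t t0).1 !mxE summxE.
  by congr (_ - _ * _); apply: eq_bigr => j _; rewrite mxE.
apply: near_ge0 (col q).2 => t t0; rewrite (sums q t t0).2 !mxE summxE.
by congr (_ - _ * _); apply: eq_bigr => j _; rewrite mxE.
Unshelve. all: by end_near. Qed.
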